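(* Let $\mathbf r_0\in C^\infty(\mathbb T;\mathbb R^3)$, $B_0\in C^\infty(\mathbb T)$ with $B_0>0$, and $\phi_{m0},\phi_{mm}\in C^\infty(\mathbb T)$ for $2\le m<\infty$, with $\ell'>0$ and $\kappa>0$ on $\mathbb T$, and let $q_0\ge 0$. Let $\phi$ be the formal near-axis solution (defined in the context) with these inputs. Then $\phi$ is not continuous with respect to perturbations of the input, in the following sense. For all $\sigma_0>0$, $\sigma>0$ and $q\ge 2$ there is a sequence of $C^\infty$ perturbations $\delta\mathbf r_0^{(j)},\ \delta B_0^{(j)},\ \delta\phi_{m0}^{(j)},\ \delta\phi_{mm}^{(j)}$ ($m\ge2$), such that the perturbed inputs are again admissible, with $$\|\delta\mathbf r_0^{(j)}\|_{C^{4+q_0}(\mathbb T)}\to0,\qquad \|\delta B_0^{(j)}\|_{H^{1+q_0}(\mathbb T)}\to0,\qquad \|\delta\phi^{(\mathrm{IC}),(j)}\|_{\sigma_0,H^{2+q_0}}\to0$$ as $j\to\infty$, but such that the near-axis solutions $\phi^{(j)}$ of the perturbed problems do not satisfy $\|\phi^{(j)}-\phi\|_{\sigma,H^q}\to0$ (the norm is taken to be $+\infty$ for formal series for which it is not finite). That is, the near-axis expansion is ill-posed in these norms.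
   Context: $\mathbb T=\mathbb R/2\pi\mathbb Z$. For a closed curve $\mathbf r_0:\mathbb T\to\mathbb R^3$ (the axis, parametrized by $s$) put $\ell'=\|\mathbf r_0'\|$, and let $\kappa$ and $\tau$ be its curvature and torsion, $\kappa=\|\mathbf r_0'\times\mathbf r_0''\|/(\ell')^3$, $\tau=(\mathbf r_0'\times\mathbf r_0'')\cdot\mathbf r_0'''/\|\mathbf r_0'\times\mathbf r_0''\|^2$. With the Frenet frame $(\mathbf n,\mathbf b,\mathbf t)$, near-axis coordinates $(\rho,\theta,s)$ are defined by $\mathbf r=\mathbf r_0(s)+\rho\cos\theta\,\mathbf n(s)+\rho\sin\theta\,\mathbf b(s)$. Put $h_s=\ell'(1-\kappa\rho\cos\theta)$, $\mathsf A=h_s$, $\mathsf B=h_s+\rho^2h_s^{-1}(\ell')^2\tau^2$, $\mathsf C=-h_s^{-1}\ell'\tau$, $\mathsf D=h_s^{-1}$, all expanded as power series in $\rho$. Near-axis problem. Inputs: $\mathbf r_0$, $B_0$, and functions $\phi_{m0}(s),\phi_{mm}(s)$ for $m\ge2$, with $\ell'>0$, $\kappa>0$, $B_0>0$ (admissible inputs), and $\phi_{00}=\phi_{10}=\phi_{11}=0$. The near-axis solution is the formal power series $$\phi=\sum_{m\ge0}\rho^m\phi_m(\theta,s),\qquad \phi_m=\sum_{n=0}^m\phi_{mn}(s)e^{(2n-m)\mathrm i\theta},$$ with the prescribed coefficients $\phi_{m0},\phi_{mm}$, that satisfies at every order in $\rho$ the equation $$\frac1{\rho^2}\Big[\rho\,\partial_\rho(\mathsf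 A\rho\,\partial_\rho\phi)+\partial_\theta(\mathsf B\,\partial_\theta\phi)\Big]=-\partial_\theta\big(\mathsf C(\partial_s\phi+B_0\ell')\big)-\partial_s(\mathsf C\,\partial_\theta\phi)-\partial_s\big(\mathsf D(\partial_s\phi+B_0\ell')\big).$$ This is Poisson's equation $\Delta\phi=-\nabla\cdot\tilde{\mathbf B}$, $\tilde{\mathbf B}=B_0\ell'\nabla s$, multiplied by $h_s$; it expresses that $\mathbf B=\nabla\phi+\tilde{\mathbf B}$ is a vacuum magnetic field equal to $B_0\mathbf t$ on the axis. The formal solution exists and is unique for $C^\infty$ inputs. The input moments are collected in $\phi^{(\mathrm{IC})}=\sum_{m}\rho^m(\phi_{m0}e^{-\mathrm im\theta}+\phi_{mm}e^{\mathrm im\theta})$, and $\delta\phi^{(\mathrm{IC})}$ is formed in the same way from $\delta\phi_{m0},\delta\phi_{mm}$. Norms. For a Banach space $W$ of functions on $\mathbb T^2$ and a series $f=\sum_m f_m(\theta,s)\rho^m$ with $f_m=\sum_{n=0}^m f_{mn}(s)e^{(2n-m)\mathrm i\theta}$, $\|f\|_{\sigma,W}=\sup_m\sigma^m\|f_m\|_W$; $f$ is called $(\sigma,W)$-analytic if this is finite. Here $H^q=H^q(\mathbb T^2)$ is the usual Sobolev space in $(\theta,s)$. *)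

(* Defs.v *)
From HB Require Import structures.
From mathcomp Require Import all_boot all_order all_algebra.
From mathcomp Require Import complex.
From mathcomp Require Import all_classical all_reals all_analysis.

Set Implicit Arguments.
Unset Strict Implicit.
Unset Printing Implicit Defensive.

Import Order.TTheory GRing.Theory Num.Theory.
Import numFieldNormedType.Exports.

Local Open Scope ring_scope.
Local Open Scope classical_set_scope.
Local Open Scope complex_scope.

(* Functions on the circle T = R/2piZ are 2pi-periodic functions on R, and
   functions on T^2 are functions R -> R -> _ of (theta, s), in this order. *)

Section Calculus.
Context {R : realType}.

Definition smooth_per {V : normedModType R} (f : R -> V) : Prop :=
  (forall n x, derivable (derive1n n f) x 1) /\ periodic f (pi *+ 2).

Definition csmooth_per (f : R -> R[i]) : Prop :=
  smooth_per (fun x => complex.Re (f x)) /\ smooth_per (fun x => complex.Im (f x)).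

Definition cderive (f : R -> R[i]) (x : R) : R[i] :=
  derive1 (fun y => complex.Re (f y)) x +i*
  derive1 (fun y => complex.Im (f y)) x.

Definition expi (x : R) : R[i] := cos x +i* sin x.

Definition abs2 (z : R[i]) : R := complex.Re z ^+ 2 + complex.Im z ^+ 2.

(* Integral over one period. *)
Definition cint (f : R -> R[i]) : R[i] :=
  (\int[lebesgue_measure]_(x in `[0, pi *+ 2]) complex.Re (f x))%R +i*
  (\int[lebesgue_measure]_(x in `[0, pi *+ 2]) complex.Im (f x))%R.

Definition dot3 (u v : 'rV[R]_3) : R := \sum_i u 0 i * v 0 i.

Definition norm3 (u : 'rV[R]_3) : R := Num.sqrt (dot3 u u).

Definition cross3 (u v : 'rV[R]_3) : 'rV[R]_3 :=
  \row_i (u 0 (i + 1) * v 0 (i + 2%:R) - u 0 (i + 2%:R) * v 0 (i + 1)).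

End Calculus.

Section Norms.
Context {R : realType}.
Local Open Scope ereal_scope.

(* The C^r norm of a curve, for real r >= 0: with k the integer part of r, the
   sum of the sup norms of the derivatives of order at most k, plus, when r is
   not an integer, the Hoelder seminorm of exponent r - k of the k-th one. *)
Definition Cnorm (r : R) (f : R -> 'rV[R]_3) : \bar R :=
  let k := Num.truncn r in
  let a := (r - k%:R)%R in
  \sum_(i < k.+1) ereal_sup [set (norm3 (derive1n i f x))%:E | x in [set: R]] +
  (if a == 0%R then 0 else
   ereal_sup [set (norm3 (derive1n k f xy.1 - derive1n k f xy.2) /
                (`|xy.1 - xy.2| `^ a))%:E
             | xy in [set xy : R * R | xy.1 != xy.2]]).

Definition fourier1 (f : R -> R[i]) (k : int) : R[i] :=
  (((pi *+ 2)^-1)%:C * cint (fun s => f s * expi (- (k%:~R * s))))%R.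

Definition fourier2 (f : R -> R -> R[i]) (j k : int) : R[i] :=
  fourier1 (fun theta => fourier1 (f theta) k) j.

(* Sobolev norms of real order q, through the Fourier coefficients. *)
Definition Hnorm1 (q : R) (f : R -> R[i]) : \bar R :=
  (\esum_(k in [set: int])
     ((1 + k%:~R ^+ 2) `^ q * abs2 (fourier1 f k))%:E) `^ (2^-1).

Definition Hnorm2 (q : R) (f : R -> R -> R[i]) : \bar R :=
  (\esum_(jk in [set: int * int])
     ((1 + jk.1%:~R ^+ 2 + jk.2%:~R ^+ 2) `^ q *
      abs2 (fourier2 f jk.1 jk.2))%:E) `^ (2^-1).

End Norms.

(* Formal power series in rho whose coefficients are functions of (theta, s). *)
Definition fseries (R : realType) : Type := nat -> R -> R -> R[i].

Section Series.
Context {R : realType}.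
Implicit Types (f g : fseries R).

Definition ser_add f g : fseries R := fun m t s => f m t s + g m t s.
Definition ser_opp f : fseries R := fun m t s => - f m t s.
Definition ser_mul f g : fseries R :=
  fun m t s => \sum_(i < m.+1) f i t s * g (m - i)%N t s.
(* Coefficients independent of rho and theta. *)
Definition ser_cst (a : R -> R) : fseries R :=
  fun m _ s => if m is 0%N then (a s)%:C else 0.
(* rho * d/drho *)
Definition ser_rhod f : fseries R := fun m t s => f m t s *+ m.
Definition ser_dtheta f : fseries R := fun m t s => cderive (fun x => f m x s) t.
Definition ser_ds f : fseries R := fun m t s => cderive (fun x => f m t x) s.
(* Multiplication by rho^2. *)
Definition ser_rho2 f : fseries R := fun m t s => if m is k.+2 then f k t s else 0.

(* The series sum_m rho^m sum_(n <= m) c_mn(s) e^((2n - m) i theta). *)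
Definition ser_of_coef (c : nat -> nat -> R -> R[i]) : fseries R :=
  fun m t s => \sum_(n < m.+1) c m n s * expi ((2 * n%:R - m%:R) * t).

Definition ser_norm (sigma : R) (W : (R -> R -> R[i]) -> \bar R) f : \bar R :=
  ereal_sup (range (fun m => ((sigma ^+ m)%:E * W (f m))%E)).

End Series.

(* Inputs of the near-axis problem: the axis r_0, the on-axis field B_0 and the
   moments phi_m0 = mom_lo m and phi_mm = mom_hi m, of which only the entries
   with m >= 2 are ever used. *)
Record nae_input (R : realType) := NaeInput {
  axis : R -> 'rV[R]_3;
  field0 : R -> R;
  mom_lo : nat -> R -> R[i];
  mom_hi : nat -> R -> R[i] }.

Section NearAxis.
Context {R : realType}.
Implicit Types (u d : nae_input R).

Definition add_input u d : nae_input R :=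
  NaeInput (fun s => axis u s + axis d s)
           (fun s => field0 u s + field0 d s)
           (fun m s => mom_lo u m s + mom_lo d m s)
           (fun m s => mom_hi u m s + mom_hi d m s).

Definition smooth_input u : Prop :=
  [/\ smooth_per (axis u), smooth_per (field0 u : R -> R^o)
    & forall m, (2 <= m)%N ->
        csmooth_per (mom_lo u m) /\ csmooth_per (mom_hi u m)].

(* The moments come from a real-valued potential. *)
Definition real_moments u : Prop :=
  forall m s, (2 <= m)%N -> mom_lo u m s = conjc (mom_hi u m s).

Definition speed u (s : R) : R := norm3 (derive1 (axis u) s).

Definition curvature u (s : R) : R :=
  norm3 (cross3 (derive1 (axis u) s) (derive1n 2 (axis u) s)) / speed u s ^+ 3.

Definition torsion u (s : R) : R :=
  let b := cross3 (derive1 (axis u) s) (derive1n 2 (axis u) s) in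
  dot3 b (derive1n 3 (axis u) s) / norm3 b ^+ 2.

Definition admissible u : Prop :=
  smooth_input u /\
  forall s, [/\ 0 < speed u s, 0 < curvature u s & 0 < field0 u s].

(* h_s = l' (1 - kappa rho cos(theta)) *)
Definition ser_hs u : fseries R := fun m t s =>
  match m with
  | 0%N => (speed u s)%:C
  | 1%N => (- (speed u s * curvature u s * cos t))%:C
  | _ => 0
  end.

(* The inverse of ser_hs, by the geometric series; see ser_hs_hsV. *)
Definition ser_hsV u : fseries R := fun m t s =>
  ((speed u s)^-1 * (curvature u s * cos t) ^+ m)%:C.

Definition serA u : fseries R := ser_hs u.
Definition serB u : fseries R :=
  ser_add (ser_hs u)
    (ser_rho2 (ser_mul (ser_hsV u)
                 (ser_cst (fun s => speed u s ^+ 2 * torsion u s ^+ 2)))).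
Definition serC u : fseries R :=
  ser_opp (ser_mul (ser_hsV u) (ser_cst (fun s => speed u s * torsion u s))).
Definition serD u : fseries R := ser_hsV u.

(* rho^2 times both sides of the near-axis Poisson equation. *)
Definition nae_lhs u (phi : fseries R) : fseries R :=
  ser_add (ser_rhod (ser_mul (serA u) (ser_rhod phi)))
          (ser_dtheta (ser_mul (serB u) (ser_dtheta phi))).

Definition nae_rhs u (phi : fseries R) : fseries R :=
  let dphiB := ser_add (ser_ds phi)
                       (ser_cst (fun s => field0 u s * speed u s)) in
  ser_rho2
    (ser_add (ser_opp (ser_dtheta (ser_mul (serC u) dphiB)))
    (ser_add (ser_opp (ser_ds (ser_mul (serC u) (ser_dtheta phi))))
             (ser_opp (ser_ds (ser_mul (serD u) dphiB))))).

Definition nae_solution u (phi : fseries R) : Prop :=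
  exists c : nat -> nat -> R -> R[i],
    [/\ phi = ser_of_coef c,
        forall m n, (n <= m)%N -> csmooth_per (c m n),
        forall s, [/\ c 0%N 0%N s = 0, c 1%N 0%N s = 0 & c 1%N 1%N s = 0],
        forall m s, (2 <= m)%N ->
          c m 0%N s = mom_lo u m s /\ c m m s = mom_hi u m s
      & forall m t s, nae_lhs u phi m t s = nae_rhs u phi m t s].

(* phi^(IC); its terms of order m < 2 vanish since phi_00 = phi_10 = phi_11 = 0. *)
Definition ser_IC u : fseries R := fun m t s =>
  if (m < 2)%N then 0
  else mom_lo u m s * expi (- (m%:R * t)) + mom_hi u m s * expi (m%:R * t).

Lemma ser_hs_hsV u m t s : speed u s != 0 ->
  ser_mul (ser_hs u) (ser_hsV u) m t s = (m == 0%N)%:R.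
Proof.
move=> l0; rewrite /ser_mul; case: m => [|m].
  by rewrite big_ord1 /ser_hs /ser_hsV /= -rmorphM /= expr0 mulr1 divff.
rewrite !big_ord_recl big1 => [|i _]; last by rewrite mul0r.
rewrite /ser_hs /ser_hsV /= addr0 subn0 subSS subn0 -!rmorphM -rmorphD /=.
rewrite -[RHS]/((0 : R)%:C); congr (_%:C).
rewrite mulrA mulfV // mul1r exprS; set k := curvature u s * cos t.
have -> : speed u s * curvature u s * cos t = k * speed u s.
  by rewrite -mulrA mulrC.
by rewrite mulNr -[k * _ * _]mulrA [speed u s * _]mulrA mulfV // mul1r subrr.
Qed.

End NearAxis.

(* Main.v *)
Require Import Defs.
From mathcomp Require Import all_boot all_order all_algebra.
From mathcomp Require Import complex.
From mathcomp Require Import all_classical all_reals all_analysis.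
From mathcomp Require Import ring lra.

(** Only [B_0] is perturbed, by [e cos (k s)] with [e] of the order of [k^-N].
    The equation being linear in [(phi, B_0)], the solution then changes by [e]
    times the response to [B_0 = cos (k s)].  Apart from [B_0] itself, every
    order in [rho] costs at most one derivative in [s], and this bound is only
    attained by the term [- d_s (l'^-1 d_s phi_(m-2))], which keeps the
    frequency in [theta].  Hence the order-[m] response, for [m] even, is
    [k^(m-1) G_m(s) sin (k s)] with [G_m > 0], up to terms of order [k^(m-2)]
    as [k] grows, and its Fourier coefficient of index [(0, k)] has modulus at
    least [c k^(m-1)].  Choosing [m] large with respect to [N], the perturbation
    tends to zero while the order-[m] term of the solution blows up. *)

Import Order.TTheory GRing.Theory Num.Theory.
Import numFieldNormedType.Exports.

Set Implicit Arguments.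
Unset Strict Implicit.
Unset Printing Implicit Defensive.

Local Open Scope ring_scope.
Local Open Scope classical_set_scope.
Local Open Scope complex_scope.

(** The axis is left alone, so the coefficients [A], [B], [C], [D] are unchanged and the perturbed
    solution is exactly [phi] plus [e] times the response: no nonlinear estimate arises. The
    obstacle is to control the remainder uniformly in [k] through a recursion that involves all
    earlier orders and derivatives of them. Norms would lose derivatives at each step; instead [osc]
    is a syntactic class of functions of [(k, theta, s)] that records a degree in [theta] and a
    bound on the powers of [k]. It is stable under every operation of the recursion, and an analytic
    estimate is made only once, on its members, in [osc_fourier2]. The degree matters too: the
    response has zero extreme moments, so its order-[m] term has degree [m - 2] in [theta], and
    there [m^2 + d_theta^2] is invertible. The chain starts at order 2: since [D_0 l' = 1], the
    source [- d_s (D_0 B_0 l')] is [k sin (k s)], to be divided by [4 l']. *)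

Local Notation smooth f := (smooth_per (f : _ -> _^o)).

(** * Smooth periodic functions *)

Section SmoothPeriodic.
Context {R : realType}.
Implicit Types (f g : R -> R).

(** [derive1n] adds derivatives on the outside, whereas the rules for products, inverses and roots
    rewrite the first derivative. Recursing into [derive1 f] makes each rule a plain induction. *)
Fixpoint diffn n f : Prop :=
  (forall x, derivable f x 1) /\ (if n is n'.+1 then diffn n' (derive1 f) else True).

Lemma diffnW n f : diffn n.+1 f -> diffn n f.
Proof.
elim: n f => [|n IHn] f [df H]; first by split.
by split=> //; apply: IHn.
Qed.

Lemma diffnP f : (forall n x, derivable (derive1n n f) x 1) <-> (forall n, diffn n f).
Proof.
split=> [H n|H n].
  elim: n f H => [|n IHn] f H; first by split=> //; apply: (H 0%N).
  split; first exact: (H 0%N).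
  by apply: IHn => m x; rewrite -derive1Sn; exact: H.
elim: n f H => [|n IHn] f H x; first by case: (H 0%N).
rewrite derive1Sn; apply: IHn => m; by case: (H m.+1).
Qed.

Lemma diffn_cst n (c : R) : diffn n (cst c).
Proof.
elim: n c => [|n IHn] c; (split; first by move=> x; exact: derivable_cst); first by [].
rewrite (_ : derive1 _ = cst 0); first exact: IHn.
by apply/funext => x; rewrite derive1_cst.
Qed.

Lemma diffnD n f g : diffn n f -> diffn n g -> diffn n (f + g).
Proof.
elim: n f g => [|n IHn] f g [df Hf] [dg Hg]; (split; first by move=> x; exact: derivableD);
  first by [].
rewrite (_ : derive1 _ = derive1 f + derive1 g); first exact: IHn.
by apply/funext => x; rewrite derive1E (deriveD (df x) (dg x)) -!derive1E.
Qed.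

Lemma diffnM n f g : diffn n f -> diffn n g -> diffn n (f * g).
Proof.
elim: n f g => [|n IHn] f g; first by move=> [df _] [dg _]; split=> [x|]; [exact: derivableM|by []].
move=> Df Dg; have [[df Hf] [dg Hg]] := (Df, Dg).
split=> [x|]; first exact: derivableM.
rewrite (_ : derive1 _ = f * derive1 g + g * derive1 f).
  by apply: diffnD; apply: IHn => //; exact: diffnW.
by apply/funext => x; rewrite derive1E (deriveM (df x) (dg x)) -!derive1E.
Qed.

(** The derivative [- f' / f^2] contains the inverse itself, at one order less, so the induction
    runs on [n] with [f] fixed. The square root is treated in the same way. *)
Lemma diffnV n f : (forall x, f x != 0) -> diffn n f -> diffn n (fun x => (f x)^-1).
Proof.
move=> f0; elim: n => [|n IHn] Df;
  first by have [df _] := Df; split=> [x|]; [exact: derivableV|by []].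
have [df Hf] := Df; split=> [x|]; first exact: derivableV.
have Vf := IHn (diffnW Df).
rewrite (_ : derive1 _ = (cst (-1) * (fun x => (f x)^-1)) * (fun x => (f x)^-1) * derive1 f).
  by apply: diffnM => //; apply: diffnM => //; apply: diffnM => //; exact: diffn_cst.
apply/funext => x; rewrite derive1E (deriveV (f0 x) (df x)) -!derive1E.
by rewrite -[RHS]/(-1 * (f x)^-1 * (f x)^-1 * derive1 f x) mulN1r -exprVn expr2 mulNr.
Qed.

Lemma diffn_sqrt n f : (forall x, 0 < f x) -> diffn n f ->
  diffn n (fun x => Num.sqrt (f x)).
Proof.
move=> f0.
have D x : derivable f x 1 -> is_derive x 1 (fun x => Num.sqrt (f x))
    ((2 * Num.sqrt (f x))^-1 * derive1 f x).
  move=> df; rewrite derive1E.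
  have Df : is_derive x 1 f ('D_1 f x) by exact/derivableP.
  have S := is_derive1_sqrt (f0 x).
  have := @is_derive1_comp R Num.sqrt f x _ _ S Df.
  by [].
elim: n => [|n IHn] Df;
  first by have [df _] := Df; split=> [x|]; [apply: ex_derive; exact: D|by []].
have [df Hf] := Df; split=> [x|]; first by apply: ex_derive; exact: D.
have Sf := IHn (diffnW Df).
rewrite (_ : derive1 _ = (fun x => ((cst 2 * (fun x => Num.sqrt (f x))) x)^-1) * derive1 f).
  apply: diffnM => //; apply: diffnV.
    by move=> x; rewrite mulf_neq0 ?pnatr_eq0// gt_eqF// sqrtr_gt0.
  by apply: diffnM => //; exact: diffn_cst.
by apply/funext => x; rewrite derive1E; have := D x (df x) => Dx; rewrite derive_val.
Qed.

(** Writing the derivative as a cosine with its phase advanced by [pi / 2] keeps the family closed;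
    hence the induction generalizes [x0]. *)
Lemma diffn_cosD n (l x0 : R) : diffn n (fun x => cos (l * x + x0)).
Proof.
have D (y0 x : R) : is_derive x (1 : R) (fun x : R => cos (l * x + y0))
    (l * cos (l * x + y0 + pi / 2)).
  rewrite cosDpihalf; have L : is_derive x (1 : R) (fun x : R => l * x + y0) l.
    by apply: is_derive_eq; rewrite addr0; exact: mulr1.
  have := @is_derive1_comp R cos _ x _ _ (is_derive_cos _) L.
  by rewrite mulrC.
elim: n x0 => [|n IHn] x0; (split; first by move=> x; apply: ex_derive; exact: D);
  first by [].
rewrite (_ : derive1 _ = cst l * (fun x => cos (l * x + (x0 + pi / 2)))).
  by apply: diffnM => //; exact: diffn_cst.
apply/funext => x; rewrite derive1E; have := D x0 x => Dx; rewrite derive_val.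
by rewrite -[RHS]/(l * cos (l * x + (x0 + pi / 2))) addrA.
Qed.


Lemma smoothE f : smooth f <-> (forall n, diffn n f) /\ periodic f (pi *+ 2).
Proof. by rewrite /smooth_per -diffnP. Qed.

Lemma smooth_cst (c : R) : smooth (fun=> c).
Proof. by apply/smoothE; split=> // n; exact: diffn_cst. Qed.

Lemma smoothD f g : smooth f -> smooth g -> smooth (fun x => f x + g x).
Proof.
move=> /smoothE[Df pf] /smoothE[Dg pg]; apply/smoothE; split=> [n|x].
  exact: (diffnD (Df n) (Dg n)).
by rewrite pf pg.
Qed.

Lemma smoothM f g : smooth f -> smooth g -> smooth (fun x => f x * g x).
Proof.
move=> /smoothE[Df pf] /smoothE[Dg pg]; apply/smoothE; split=> [n|x].
  exact: (diffnM (Df n) (Dg n)).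
by rewrite pf pg.
Qed.

Lemma smoothN f : smooth f -> smooth (fun x => - f x).
Proof.
move=> sf; rewrite (_ : (fun _ => _) = fun x => -1 * f x).
  by apply: smoothM => //; exact: smooth_cst.
by apply/funext => x; rewrite mulN1r.
Qed.

Lemma smoothB f g : smooth f -> smooth g -> smooth (fun x => f x - g x).
Proof. by move=> sf sg; apply: smoothD => //; exact: smoothN. Qed.

Lemma smoothX f n : smooth f -> smooth (fun x => f x ^+ n).
Proof.
move=> sf; elim: n => [|n IHn]; first exact: smooth_cst.
rewrite (_ : (fun _ => _) = fun x => f x * f x ^+ n); first exact: smoothM.
by apply/funext => x; rewrite exprS.
Qed.

Lemma smooth_sum (I : finType) (F : I -> R -> R) :
  (forall i, smooth (F i)) -> smooth (fun x => \sum_i F i x).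
Proof.
move=> sF; elim: (index_enum I) => [|i s IHs].
  by under eq_fun do rewrite big_nil; exact: smooth_cst.
by under eq_fun do rewrite big_cons; exact: smoothD.
Qed.

Lemma smoothV f : (forall x, f x != 0) -> smooth f -> smooth (fun x => (f x)^-1).
Proof.
move=> f0 /smoothE[Df pf]; apply/smoothE; split=> [n|x]; first exact: diffnV.
by rewrite pf.
Qed.

Lemma smooth_sqrt f : (forall x, 0 < f x) -> smooth f ->
  smooth (fun x => Num.sqrt (f x)).
Proof.
move=> f0 /smoothE[Df pf]; apply/smoothE; split=> [n|x]; first exact: diffn_sqrt.
by rewrite pf.
Qed.

Lemma smooth_cosD (l k : nat) (x0 : R) : smooth (fun x => cos (l%:R * k%:R * x + x0)).
Proof.
apply/smoothE; split=> [n|x]; first exact: diffn_cosD.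
rewrite mulrDr -natrM mulr_natl mulr_natl addrAC.
exact: (periodicn (@cosD2pi R)).
Qed.

Lemma periodic_derive1 (V : normedModType R) (f : R -> V) (T : R) :
  periodic f T -> periodic (derive1 f) T.
Proof.
move=> pf x; rewrite /derive1.
rewrite (_ : (fun h => h^-1 *: _) = (fun h => h^-1 *: (f (h + x) - f x)))//.
by apply/funext => h; rewrite addrA !pf.
Qed.

Lemma periodic_derive1n (V : normedModType R) (f : R -> V) (T : R) n :
  periodic f T -> periodic (derive1n n f) T.
Proof.
by move=> pf; elim: n => // n IHn; rewrite derive1nS; exact: periodic_derive1.
Qed.

Lemma smooth_derive1 f : smooth f -> smooth (derive1 f).
Proof.
move=> [df pf]; split=> [n x|]; last exact: periodic_derive1.
by rewrite -derive1Sn; exact: df.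
Qed.

Lemma smooth_derivable f x : smooth f -> derivable f x 1.
Proof. by move=> [df _]; exact: (df 0%N). Qed.

Lemma smooth_continuous f : smooth f -> continuous f.
Proof.
by move=> sf x; exact/differentiable_continuous/derivable1_diffP/smooth_derivable.
Qed.

Lemma smooth_coord m n (f : R -> 'M[R]_(m, n)) k i j : smooth_per f ->
  smooth (fun x => derive1n k f x i j).
Proof.
move=> [df pf].
have E p q : derive1n p (fun x => derive1n q f x i j) = fun x => derive1n (p + q) f x i j.
  elim: p => // p IHp; rewrite derive1nS IHp addSn derive1nS; apply/funext => x.
  by rewrite !derive1E derive_mx ?mxE//; exact: df.
split=> [p x|x]; last by rewrite (periodic_derive1n _ pf).
by rewrite E; apply: (derivable_mxP _ _ _).1; exact: df.
Qed.

Lemma smooth_lbound f : smooth f -> (forall x, 0 < f x) ->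
  exists2 e, 0 < e & forall x, 0 <= x <= pi *+ 2 -> e <= f x.
Proof.
move=> sf f0.
have p0 : 0 <= pi *+ 2 :> R by rewrite mulrn_wge0// pi_ge0.
have [|c _ Hc] := @EVT_min R f _ _ p0.
  by apply: continuous_subspaceT => x; exact: (smooth_continuous sf).
by exists (f c) => // x x2; apply: Hc; rewrite in_itv.
Qed.

Lemma smooth_ubound f : smooth f ->
  exists2 e, 0 <= e & forall x, 0 <= x <= pi *+ 2 -> `|f x| <= e.
Proof.
move=> sf.
have p0 : 0 <= pi *+ 2 :> R by rewrite mulrn_wge0// pi_ge0.
have [|c _ Hc] := @EVT_max R (fun x => `|f x|) _ _ p0.
  apply: continuous_subspaceT => x; apply: continuous_comp; first exact: (smooth_continuous sf).
  exact: norm_continuous.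
by exists `|f c| => // x x2; apply: Hc; rewrite in_itv.
Qed.

Lemma periodicz f (T : R) (k : int) y : periodic f T -> f (y + T *~ k) = f y.
Proof.
move=> pf; case: k => n; first exact: (periodicn pf).
by rewrite NegzE mulrNz -(periodicn pf n.+1) subrK.
Qed.

Lemma periodic_reduce f x : periodic f (pi *+ 2) ->
  exists2 y, 0 <= y <= pi *+ 2 & f x = f y.
Proof.
move=> pf; have p0 : 0 < pi *+ 2 :> R by rewrite mulrn_wgt0// pi_gt0.
pose k := Num.floor (x / (pi *+ 2)).
have /andP[kx xk] := floor_itv (x / (pi *+ 2)).
exists (x - (pi *+ 2) *~ k); last by rewrite -mulrNz periodicz.
rewrite subr_ge0 -mulrzl -ler_pdivlMr// kx /= lerBlDr.
by move: xk; rewrite ltr_pdivrMr// intrD mulrDl mul1r addrC => /ltW.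
Qed.

End SmoothPeriodic.

(** * Oscillating trigonometric polynomials *)

Section ComplexCalculus.
Context {R : realType}.
Implicit Types (f g : R -> R[i]) (z w : R[i]).

Lemma Re_add z w : complex.Re (z + w) = complex.Re z + complex.Re w.
Proof. by case: z; case: w. Qed.
Lemma Im_add z w : complex.Im (z + w) = complex.Im z + complex.Im w.
Proof. by case: z; case: w. Qed.
Lemma Re_mul z w : complex.Re (z * w) =
  complex.Re z * complex.Re w - complex.Im z * complex.Im w.
Proof. by case: z; case: w. Qed.
Lemma Im_mul z w : complex.Im (z * w) =
  complex.Re z * complex.Im w + complex.Im z * complex.Re w.
Proof. by case: z; case: w. Qed.
Lemma complex_ext z w :
  complex.Re z = complex.Re w -> complex.Im z = complex.Im w -> z = w.
Proof. by case: z => a b; case: w => c d /= -> ->. Qed.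

(** [cderive] has a value even where [f] is not differentiable. This relation carries
    differentiability along with the value, so derivatives are assembled by composing proofs. *)
Definition cder f (x : R) (d : R[i]) : Prop :=
  is_derive x (1 : R) (fun y => complex.Re (f y)) (complex.Re d) /\
  is_derive x (1 : R) (fun y => complex.Im (f y)) (complex.Im d).

Lemma cderE f x d : cder f x d -> cderive f x = d.
Proof.
move=> [dr di]; rewrite /cderive !derive1E.
by apply: complex_ext => /=; rewrite derive_val.
Qed.

Lemma cder_cst z x : cder (fun=> z) x 0.
Proof. by split; exact: is_derive_cst. Qed.

Lemma cderD f g x d e : cder f x d -> cder g x e ->
  cder (fun y => f y + g y) x (d + e).
Proof.
move=> [dr di] [er ei]; split.
  rewrite (_ : (fun _ => _) = (fun y => complex.Re (f y)) + (fun y => complex.Re (g y))).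
    by rewrite Re_add; exact: is_deriveD.
  by apply/funext => y; rewrite Re_add.
rewrite (_ : (fun _ => _) = (fun y => complex.Im (f y)) + (fun y => complex.Im (g y))).
  by rewrite Im_add; exact: is_deriveD.
by apply/funext => y; rewrite Im_add.
Qed.

Lemma cderM f g x d e : cder f x d -> cder g x e ->
  cder (fun y => f y * g y) x (d * g x + f x * e).
Proof.
move=> [dr di] [er ei]; split.
  rewrite (_ : (fun _ => _) = (fun y => complex.Re (f y)) * (fun y => complex.Re (g y))
     - (fun y => complex.Im (f y)) * (fun y => complex.Im (g y))).
    by apply: is_derive_eq; rewrite Re_add !Re_mul /GRing.scale /=; ring.
  by apply/funext => y; rewrite Re_mul.
rewrite (_ : (fun _ => _) = (fun y => complex.Re (f y)) * (fun y => complex.Im (g y))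
     + (fun y => complex.Im (f y)) * (fun y => complex.Re (g y))).
  by apply: is_derive_eq; rewrite Im_add !Im_mul /GRing.scale /=; ring.
by apply/funext => y; rewrite Im_mul.
Qed.

Lemma is_derive_lin (a b x : R) : is_derive x (1 : R) (fun x : R => a * x + b) a.
Proof. by apply: is_derive_eq; rewrite addr0; exact: mulr1. Qed.

Lemma cder_cosD (a b x : R) :
  cder (fun x => (cos (a * x + b))%:C) x (a * cos (a * x + b + pi / 2))%:C.
Proof.
split=> /=; last exact: is_derive_cst.
rewrite cosDpihalf mulrC.
exact: (@is_derive1_comp R cos _ x _ _ (is_derive_cos _) (is_derive_lin _ _ _)).
Qed.

Lemma cder_expi (a x : R) : cder (fun x => expi (a * x)) x ((0 +i* a) * expi (a * x)).
Proof.
have L : is_derive x (1 : R) (fun x : R => a * x) a.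
  by apply: is_derive_eq; exact: mulr1.
split; rewrite ?Re_mul ?Im_mul /= mul0r ?add0r ?sub0r ?addr0.
  rewrite mulrC -mulNr.
  exact: (@is_derive1_comp R cos _ x _ _ (is_derive_cos _) L).
rewrite mulrC.
exact: (@is_derive1_comp R sin _ x _ _ (is_derive_sin _) L).
Qed.

Lemma expiD (x y : R) : expi (x + y) = expi x * expi y.
Proof.
by apply: complex_ext; rewrite ?Re_mul ?Im_mul /= ?cosD ?sinD//; ring.
Qed.

Lemma expi0 : expi 0 = 1 :> R[i].
Proof. by rewrite /expi cos0 sin0. Qed.

Lemma cos_expi (t : R) : (cos t)%:C = 2^-1 * (expi t + expi (- t)).
Proof.
rewrite (_ : 2^-1 = (2^-1)%:C); last by rewrite fmorphV /= rmorph_nat.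
apply: complex_ext; rewrite ?Re_mul ?Im_mul /= ?cosN ?sinN; lra.
Qed.

Lemma csmooth_cst z : csmooth_per (fun=> z).
Proof. by split; exact: smooth_cst. Qed.

Lemma csmooth_real (f : R -> R) : smooth f -> csmooth_per (fun x => (f x)%:C).
Proof. by move=> sf; split=> //=; exact: smooth_cst. Qed.

Lemma csmoothD f g : csmooth_per f -> csmooth_per g -> csmooth_per (fun x => f x + g x).
Proof.
move=> [fr fi] [gr gi]; split.
  by under eq_fun do rewrite Re_add; exact: smoothD.
by under eq_fun do rewrite Im_add; exact: smoothD.
Qed.

Lemma csmoothM f g : csmooth_per f -> csmooth_per g -> csmooth_per (fun x => f x * g x).
Proof.
move=> [fr fi] [gr gi]; split.
  by under eq_fun do rewrite Re_mul; apply: smoothB; exact: smoothM.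
by under eq_fun do rewrite Im_mul; apply: smoothD; exact: smoothM.
Qed.

Lemma csmooth_cderive f : csmooth_per f -> csmooth_per (cderive f).
Proof. by move=> [fr fi]; split=> /=; exact: smooth_derive1. Qed.

Lemma csmooth_cder f x : csmooth_per f -> cder f x (cderive f x).
Proof.
move=> [[fr _] [fi _]]; split=> /=; rewrite derive1E; apply/derivableP.
  exact: (fr 0%N).
exact: (fi 0%N).
Qed.

End ComplexCalculus.

Definition dtheta {R : realType} (f : R -> R -> R[i]) (t s : R) : R[i] :=
  cderive (fun x => f x s) t.
Definition ds {R : realType} (f : R -> R -> R[i]) (t s : R) : R[i] :=
  cderive (fun x => f t x) s.

Section Oscillating.
Context {R : realType}.
Implicit Types (f g : nat -> R -> R -> R[i]) (M r k : nat).

(* The order in [k] is strictly below [r]; as [l] is a natural number, the case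
   [l = 0] covers the functions that do not depend on [k]. *)
Inductive osc M r : (nat -> R -> R -> R[i]) -> Prop :=
| osc0 : osc M r (fun _ _ _ => 0)
| osc_gen a n l x (c : R -> R[i]) : (a < r)%N -> (n <= M)%N -> csmooth_per c ->
    osc M r (fun k t s => (k%:R ^+ a * cos (l%:R * k%:R * s + x))%:C * c s *
                          expi ((2 * n%:R - M%:R) * t))
| oscD f g : osc M r f -> osc M r g -> osc M r (fun k t s => f k t s + g k t s).

Lemma osc_ext M r f g : osc M r f -> (forall k t s, f k t s = g k t s) -> osc M r g.
Proof.
move=> Tf fg; rewrite (_ : g = f)//.
by apply/funext=> k; apply/funext=> t; apply/funext.
Qed.

Lemma osc_le M r r' f : (r <= r')%N -> osc M r f -> osc M r' f.
Proof.
move=> rr'; elim=> [|a n l x c ar nM sc|{}f g _ Tf _ Tg]; first exact: osc0.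
  by apply: osc_gen => //; exact: leq_trans rr'.
exact: oscD.
Qed.

Lemma oscM M r f (h : R -> R[i]) : csmooth_per h -> osc M r f ->
  osc M r (fun k t s => h s * f k t s).
Proof.
move=> sh; elim=> [|a n l x c ar nM sc|{}f g _ Tf _ Tg].
- by apply: osc_ext (osc0 _ _) _ => k t s; rewrite mulr0.
- apply: osc_ext (osc_gen l x ar nM (csmoothM sh sc)) _ => k t s; ring.
- by apply: osc_ext (oscD Tf Tg) _ => k t s; rewrite mulrDr.
Qed.

Lemma oscZ M r f (z : R[i]) : osc M r f -> osc M r (fun k t s => z * f k t s).
Proof. by apply: oscM; exact: csmooth_cst. Qed.

Lemma oscN M r f : osc M r f -> osc M r (fun k t s => - f k t s).
Proof. by move=> /(oscZ (-1)) Tf; apply: osc_ext Tf _ => k t s; rewrite mulN1r. Qed.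

Lemma oscB M r f g : osc M r f -> osc M r g -> osc M r (fun k t s => f k t s - g k t s).
Proof. by move=> Tf Tg; apply: oscD => //; exact: oscN. Qed.

Lemma osc_mulrn M r f n : osc M r f -> osc M r (fun k t s => f k t s *+ n).
Proof. by move=> /(oscZ n%:R) Tf; apply: osc_ext Tf _ => k t s; rewrite mulr_natl. Qed.

Lemma osc_sum M r n (F : 'I_n -> nat -> R -> R -> R[i]) :
  (forall i, osc M r (F i)) -> osc M r (fun k t s => \sum_i F i k t s).
Proof.
move=> TF; elim: (index_enum _) => [|i e IHe].
  by apply: osc_ext (osc0 _ _) _ => k t s; rewrite big_nil.
by apply: osc_ext (oscD (TF i) IHe) _ => k t s; rewrite big_cons.
Qed.

(** By Euler's formula the frequency [2 n - M] splits into [2 n - M + 1] and [2 n - M - 1], which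
    are the indices [n + 1] and [n] at degree [M + 1]. *)
Lemma osc_cos M r f : osc M r f -> osc M.+1 r (fun k t s => (cos t)%:C * f k t s).
Proof.
elim=> [|a n l x c ar nM sc|{}f g _ Tf _ Tg].
- by apply: osc_ext (osc0 _ _) _ => k t s; rewrite mulr0.
- have T1 : (n.+1 <= M.+1)%N by [].
  have T2 : (n <= M.+1)%N by exact: leqW.
  have := oscZ 2^-1 (oscD (osc_gen l x ar T1 sc) (osc_gen l x ar T2 sc)).
  move/osc_ext; apply => k t s; rewrite cos_expi.
  have -> : (2 * n.+1%:R - M.+1%:R) * t = (2 * n%:R - M%:R) * t + t :> R.
    by rewrite -!natr1; ring.
  have -> : (2 * n%:R - M.+1%:R) * t = (2 * n%:R - M%:R) * t - t :> R.
    by rewrite -!natr1; ring.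
  by rewrite !expiD; ring.
- by apply: osc_ext (oscD Tf Tg) _ => k t s; rewrite mulrDr.
Qed.

(** Frequencies have the parity of [M], so the degree can only be raised by steps of 2. *)
Lemma osc_raise M r f : osc M r f -> osc M.+2 r f.
Proof.
elim=> [|a n l x c ar nM sc|{}f g _ Tf _ Tg]; first exact: osc0; last exact: oscD.
have T1 : (n.+1 <= M.+2)%N by exact: leqW.
apply: osc_ext (osc_gen l x ar T1 sc) _ => k t s.
by rewrite -!natr1; congr (_ * expi _); ring.
Qed.

(** Once [k] is frozen, the oscillating factor is one more smooth coefficient. This brings a single
    series under the rules proved for families. *)
Lemma osc_fix M r f k : osc M r f -> osc M 1 (fun=> f k).
Proof.
elim=> [|a n l x c ar nM sc|{}f g _ Tf _ Tg]; [exact: osc0| |exact: oscD].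
have sc' : csmooth_per (fun s => (k%:R ^+ a * cos (l%:R * k%:R * s + x))%:C * c s).
  by apply: csmoothM => //; apply/csmooth_real/smoothM; [exact: smooth_cst|exact: smooth_cosD].
apply: osc_ext (osc_gen 0 0 (ltn0Sn 0) nM sc') _ => j t s.
by rewrite expr0 !mul0r addr0 cos0 !mul1r.
Qed.

Lemma osc_cst M m n (c : R -> R[i]) : (n <= m)%N -> csmooth_per c ->
  m = M -> osc M 1 (fun k t s => c s * expi ((2 * n%:R - m%:R) * t)).
Proof.
move=> nm sc <-; apply: osc_ext (osc_gen 0 0 (ltn0Sn 0) nm sc) _ => k t s.
by rewrite expr0 !mul0r addr0 cos0 !mul1r.
Qed.

Lemma osc_cder_t M r f k t s : osc M r f ->
  cder (fun x => f k x s) t (dtheta (f k) t s).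
Proof.
move=> Tf; suff [d Hd] : exists d, cder (fun x => f k x s) t d.
  by rewrite /dtheta (cderE Hd).
elim: Tf => [|a n l x c ar nM sc|{}f g _ [d Hd] _ [e He]].
- by exists 0; exact: cder_cst.
- eexists; apply: cderM; first exact: cder_cst.
  exact: cder_expi.
- by eexists; exact: cderD Hd He.
Qed.

Lemma osc_cder_s M r f k t s : osc M r f ->
  cder (fun x => f k t x) s (ds (f k) t s).
Proof.
move=> Tf; suff [d Hd] : exists d, cder (fun x => f k t x) s d.
  by rewrite /ds (cderE Hd).
elim: Tf => [|a n l x c ar nM sc|{}f g _ [d Hd] _ [e He]].
- by exists 0; exact: cder_cst.
- eexists; apply: cderM; last exact: cder_cst.
  apply: cderM; last exact: csmooth_cder.
  under eq_fun do rewrite rmorphM /=.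
  apply: cderM; first exact: cder_cst.
  exact: cder_cosD.
- by eexists; exact: cderD Hd He.
Qed.

Lemma dtheta_gen (h : R -> R[i]) (a t s : R) :
  dtheta (fun t s => h s * expi (a * t)) t s = (0 +i* a) * (h s * expi (a * t)).
Proof.
by rewrite /dtheta (cderE (cderM (cder_cst _ _) (cder_expi _ _))); ring.
Qed.

Lemma dthetaD M r M' r' f g k t s : osc M r f -> osc M' r' g ->
  dtheta (fun t s => f k t s + g k t s) t s = dtheta (f k) t s + dtheta (g k) t s.
Proof. by move=> Tf Tg; exact: (cderE (cderD (osc_cder_t k t s Tf) (osc_cder_t k t s Tg))). Qed.

Lemma dsD M r M' r' f g k t s : osc M r f -> osc M' r' g ->
  ds (fun t s => f k t s + g k t s) t s = ds (f k) t s + ds (g k) t s.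
Proof. by move=> Tf Tg; exact: (cderE (cderD (osc_cder_s k t s Tf) (osc_cder_s k t s Tg))). Qed.

Lemma dthetaZ M r f k t s z : osc M r f ->
  dtheta (fun t s => z * f k t s) t s = z * dtheta (f k) t s.
Proof.
move=> Tf; apply: etrans (cderE (cderM (cder_cst z _) (osc_cder_t k t s Tf))) _.
by rewrite mul0r add0r.
Qed.

Lemma dsZ M r f k t s z : osc M r f ->
  ds (fun t s => z * f k t s) t s = z * ds (f k) t s.
Proof.
move=> Tf; apply: etrans (cderE (cderM (cder_cst z _) (osc_cder_s k t s Tf))) _.
by rewrite mul0r add0r.
Qed.

Lemma osc_dtheta M r f : osc M r f -> osc M r (fun k => dtheta (f k)).
Proof.
elim=> [|a n l x c ar nM sc|{}f g Tf Df Tg Dg].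
- apply: osc_ext (osc0 _ _) _ => k t s.
  by rewrite /dtheta (cderE (cder_cst _ _)).
- have := oscZ (0 +i* (2 * n%:R - M%:R)) (osc_gen l x ar nM sc).
  by move/osc_ext; apply => k t s; rewrite dtheta_gen.
- by apply: osc_ext (oscD Df Dg) _ => k t s; rewrite (dthetaD _ _ _ Tf Tg).
Qed.

Lemma osc_ds M r f : osc M r f -> osc M r.+1 (fun k => ds (f k)).
Proof.
elim=> [|a n l x c ar nM sc|{}f g Tf Df Tg Dg].
- apply: osc_ext (osc0 _ _) _ => k t s.
  by rewrite /ds (cderE (cder_cst _ _)).
- have ar' : (a < r.+1)%N by exact: leqW.
  have T1 := osc_gen l x ar' nM (csmooth_cderive sc).
  have ar1 : (a.+1 < r.+1)%N by [].
  have T2 := oscZ l%:R (osc_gen l (x + pi / 2) ar1 nM sc).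
  apply: osc_ext (oscD T1 T2) _ => k t s; rewrite /ds.
  have E1 := cderM (cder_cst ((k%:R : R) ^+ a)%:C s) (cder_cosD (l%:R * k%:R) x s).
  have := cderM (cderM E1 (csmooth_cder s sc))
            (cder_cst (expi ((2 * n%:R - M%:R) * t)) s).
  under eq_fun do rewrite -rmorphM /=.
  move/cderE => ->; rewrite exprS !rmorphM /= !rmorph_nat -!addrA; ring.
- by apply: osc_ext (oscD Df Dg) _ => k t s; rewrite (dsD _ _ _ Tf Tg).
Qed.

(* [p^2 - j^2 <> 0] for all the frequencies [j] of [f] as soon as [p > M]. *)
Lemma osc_inv M p r f (h : R -> R) : p = M.+2 -> (forall s, h s != 0) -> smooth h -> osc M r f ->
  exists2 g, osc M r g & forall k t s,
    (h s)%:C * (g k t s *+ p *+ p + dtheta (dtheta (g k)) t s) = f k t s.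
Proof.
move=> pE h0 sh; elim=> [|a n l x c ar nM sc|{}f f' _ [g Tg Eg] _ [g' Tg' Eg']].
- exists (fun _ _ _ => 0); first exact: osc0.
  move=> k t s; rewrite !mul0rn add0r.
  have E : dtheta (fun _ _ : R => 0 : R[i]) = fun _ _ => 0.
    by apply/funext=> u; apply/funext => v; rewrite /dtheta (cderE (cder_cst _ _)).
  by rewrite !E mulr0.
- rewrite {p}pE; pose D : R := M.+2%:R ^+ 2 - (2 * n%:R - M%:R) ^+ 2.
  have D0 : D != 0.
    have -> : D = (4 * n.+1 * (M - n).+1)%:R.
      by rewrite /D !natrM -![in RHS]natr1 natrB// -[M.+2%:R]natr1 -[M.+1%:R]natr1; ring.
    by rewrite pnatr_eq0.
  have sc' : csmooth_per (fun s => (D^-1 * (h s)^-1)%:C * c s).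
    apply: csmoothM => //; apply/csmooth_real/smoothM; first exact: smooth_cst.
    exact: smoothV.
  exists (fun k t s => (k%:R ^+ a * cos (l%:R * k%:R * s + x))%:C *
      ((D^-1 * (h s)^-1)%:C * c s) * expi ((2 * n%:R - M%:R) * t)).
    exact: osc_gen.
  move=> k t s.
  pose H s := (k%:R ^+ a * cos (l%:R * k%:R * s + x))%:C * ((D^-1 * (h s)^-1)%:C * c s).
  have E1 : dtheta (fun t s => H s * expi ((2 * n%:R - M%:R) * t)) =
    fun t s => ((0 +i* (2 * n%:R - M%:R)) * H s) * expi ((2 * n%:R - M%:R) * t).
    by apply/funext=> u; apply/funext => v; rewrite dtheta_gen mulrA.
  rewrite -/(H s) E1 dtheta_gen -[_ *+ M.+2 *+ M.+2]mulr_natr -[_ *+ M.+2]mulr_natr.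
  set e := expi _; set j := 2 * n%:R - M%:R.
  have -> : H s * e * M.+2%:R * M.+2%:R + (0 +i* j) * ((0 +i* j) * H s * e) =
      D%:C * (H s * e).
    have -> : D%:C = M.+2%:R * M.+2%:R + (0 +i* j) * (0 +i* j).
      rewrite -[X in X * X + _](rmorph_nat (real_complex R)) -rmorphM /=.
      by apply: complex_ext; rewrite ?Re_add ?Im_add ?Re_mul ?Im_mul /= /D /j ?expr2; ring.
    by ring.
  rewrite /H [(D^-1 * _)%:C]rmorphM /= !fmorphV /=.
  have hC : (h s)%:C != 0 by rewrite fmorph_eq0.
  have DC : D%:C != 0 by rewrite fmorph_eq0.
  by field; rewrite hC DC.
- exists (fun k t s => g k t s + g' k t s); first exact: oscD.
  move=> k t s; rewrite -Eg -Eg' !mulrnDl.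
  have -> : dtheta (fun t s => g k t s + g' k t s) =
      fun t s => dtheta (g k) t s + dtheta (g' k) t s.
    by apply/funext=> u; apply/funext=> v; rewrite (dthetaD _ _ _ Tg Tg').
  rewrite (dthetaD _ _ _ (osc_dtheta Tg) (osc_dtheta Tg')) -mulrDr; congr (_ * _); exact: addrACA.
Qed.

(** The way back from the class to the explicit coefficients that [nae_solution] asks for. *)
Lemma osc_coef M r f k : osc M r f -> exists2 c : nat -> R -> R[i],
  (forall n, csmooth_per (c n)) &
  forall t s, f k t s = \sum_(n < M.+1) c n s * expi ((2 * n%:R - M%:R) * t).
Proof.
elim=> [|a n l x c ar nM sc|{}f g _ [c sc Ec] _ [d sd Ed]].
- exists (fun _ _ => 0) => [n|t s]; first exact: csmooth_cst.
  by rewrite big1// => i _; rewrite mul0r.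
- exists (fun p s => if p == n then (k%:R ^+ a * cos (l%:R * k%:R * s + x))%:C * c s
                     else 0) => [p|t s].
    case: eqP => _; last exact: csmooth_cst.
    by apply: csmoothM => //; apply/csmooth_real/smoothM; [exact: smooth_cst|exact: smooth_cosD].
  rewrite (bigD1 (Ordinal (nM : n < M.+1)%N))//= eqxx big1 ?addr0// => i ni.
  by rewrite ifN ?mul0r.
- exists (fun n s => c n s + d n s) => [n|t s]; first exact: csmoothD.
  by rewrite Ec Ed -big_split /=; apply: eq_bigr => i _; rewrite [RHS]mulrDl.
Qed.

End Oscillating.

(** * The near-axis equation *)

Section Geometry.
Context {R : realType}.
Implicit Types u : nae_input R.

Lemma smooth_dot3 (v w : R -> 'rV[R]_3) :
  (forall i, smooth (fun s => v s 0 i)) -> (forall i, smooth (fun s => w s 0 i)) ->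
  smooth (fun s => dot3 (v s) (w s)).
Proof. by move=> sv sw; apply: smooth_sum => i; exact: smoothM. Qed.

Lemma smooth_cross3 (v w : R -> 'rV[R]_3) i :
  (forall i, smooth (fun s => v s 0 i)) -> (forall i, smooth (fun s => w s 0 i)) ->
  smooth (fun s => cross3 (v s) (w s) 0 i).
Proof.
move=> sv sw; rewrite /cross3; under eq_fun do rewrite mxE.
by apply: smoothB; exact: smoothM.
Qed.

Variable u : nae_input R.
Hypothesis hu : admissible u.

Let sr i k : smooth (fun s => derive1n k (axis u) s 0 i).
Proof. by case: hu => -[sa _ _] _; exact: smooth_coord. Qed.

Lemma speed_gt0 s : 0 < speed u s.
Proof. by case: hu => _ /(_ s)[]. Qed.

Lemma speed_neq0 s : speed u s != 0.
Proof. by rewrite gt_eqF// speed_gt0. Qed.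

Lemma smooth_speed : smooth (speed u).
Proof.
apply: smooth_sqrt => [s|]; first by have := speed_gt0 s; rewrite sqrtr_gt0.
by apply: smooth_dot3 => i; exact: (sr i 1).
Qed.

Let bin s := cross3 (derive1 (axis u) s) (derive1n 2 (axis u) s).

Let sbin i : smooth (fun s => bin s 0 i).
Proof. by apply: smooth_cross3 => j; [exact: (sr j 1)|exact: (sr j 2)]. Qed.

(** This is what positive curvature provides: the norm of the binormal vector stays off the
    singularity of the square root, and the denominator of the torsion does not vanish. *)
Let bin_gt0 s : 0 < norm3 (bin s).
Proof.
case: hu => _ /(_ s)[l0 + _]; rewrite /curvature -/(bin s).
by rewrite pmulr_lgt0// invr_gt0 exprn_gt0.
Qed.

Let snbin : smooth (fun s => norm3 (bin s)).
Proof.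
apply: smooth_sqrt => [s|]; first by have := bin_gt0 s; rewrite sqrtr_gt0.
exact: smooth_dot3.
Qed.

Lemma smooth_curvature : smooth (curvature u).
Proof.
apply: (smoothM snbin); apply: (smoothV _ (smoothX 3 smooth_speed)) => s.
by rewrite expf_neq0// speed_neq0.
Qed.

Lemma smooth_torsion : smooth (torsion u).
Proof.
apply: smoothM; first by apply: smooth_dot3 => i; [exact: sbin|exact: (sr i 3)].
apply: smoothV => [s|]; first by rewrite expf_neq0// gt_eqF//; exact: bin_gt0.
exact: (smoothX 2 snbin).
Qed.

End Geometry.

(** * Coefficients of the equation as multipliers *)

Section Multipliers.
Context {R : realType}.
Implicit Types (u : nae_input R) (X : fseries R).

(** The order-[i] coefficient of [X] acts as a trigonometric polynomial of degree [i] in [theta],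
    smooth in [s] and free of [k]. Only this action is ever used, so it serves as the definition. *)
Definition osc_mult X := forall i M r f, osc M r f ->
  osc (i + M) r (fun k t s => X i t s * f k t s).

Lemma ser_mul_cst X (a : R -> R) m t s :
  ser_mul X (ser_cst a) m t s = X m t s * (a s)%:C.
Proof.
rewrite /ser_mul big_ord_recr /= subnn big1 ?add0r// => i _.
have := ltn_ord i; rewrite -subn_gt0 /ser_cst /=.
by case: (m - i)%N => // n _; rewrite mulr0.
Qed.

Variable u : nae_input R.
Hypothesis hu : admissible u.

Lemma osc_mult_hs : osc_mult (ser_hs u).
Proof.
have sl := smooth_speed hu.
case=> [|[|i]] M r f Tf /=.
- exact: (oscM (csmooth_real sl) Tf).
- rewrite add1n.
  have sk : csmooth_per (fun s => (- (speed u s * curvature u s))%:C).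
    exact: (csmooth_real (smoothN (smoothM sl (smooth_curvature hu)))).
  apply: osc_ext (oscM sk (osc_cos Tf)) _ => k t s.
  by rewrite -[in RHS]mulNr [in RHS]rmorphM /= mulrA.
- by apply: osc_ext (osc0 _ _) _ => k t s; rewrite mul0r.
Qed.

(** Each further term of the geometric series brings one factor [kappa cos theta], hence one
    degree. *)
Lemma osc_mult_hsV : osc_mult (ser_hsV u).
Proof.
have sl := smooth_speed hu.
elim=> [|i IHi] M r f Tf /=.
  have sV : csmooth_per (fun s => (speed u s)^-1%:C).
    exact: (csmooth_real (smoothV (speed_neq0 hu) sl)).
  by apply: osc_ext (oscM sV Tf) _ => k t s; rewrite /ser_hsV expr0 mulr1.
have sk : csmooth_per (fun s => (curvature u s)%:C) by exact: (csmooth_real (smooth_curvature hu)).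
apply: osc_ext (oscM sk (osc_cos (IHi _ _ _ Tf))) _ => k t s.
rewrite /ser_hsV exprS [in RHS]mulrCA [in RHS]rmorphM [X in _ = X * _ * _]rmorphM /=.
by rewrite !mulrA.
Qed.

Lemma osc_mult_serB : osc_mult (serB u).
Proof.
move=> i M r f Tf; rewrite /serB /ser_add.
under eq_fun do under eq_fun do under eq_fun do rewrite mulrDl.
apply: oscD; first exact: osc_mult_hs.
case: i => [|[|i]]; try by apply: osc_ext (osc0 _ _) _ => k t s; rewrite mul0r.
(* The shift by [rho^2] places a coefficient of degree [i] at order [i + 2]; raising the degree by 2
   makes up the difference. *)
rewrite /ser_rho2 !addSn; apply: osc_raise.
have sc : csmooth_per (fun s => (speed u s ^+ 2 * torsion u s ^+ 2)%:C).
  exact: (csmooth_real (smoothM (smoothX 2 (smooth_speed hu)) (smoothX 2 (smooth_torsion hu)))).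
apply: osc_ext (osc_mult_hsV i (oscM sc Tf)) _ => k t s.
by rewrite ser_mul_cst mulrA.
Qed.

Lemma osc_mult_serC : osc_mult (serC u).
Proof.
move=> i M r f Tf.
have sc : csmooth_per (fun s => (speed u s * torsion u s)%:C).
  exact: (csmooth_real (smoothM (smooth_speed hu) (smooth_torsion hu))).
apply: osc_ext (oscN (osc_mult_hsV i (oscM sc Tf))) _ => k t s.
by rewrite /serC /ser_opp ser_mul_cst mulNr mulrA.
Qed.

End Multipliers.

(* The frequencies are those of a trigonometric polynomial of degree [m - e],
   with the natural convention for [m < e]. *)
Definition oscs {R : realType} (e r m : nat) (f : nat -> R -> R -> R[i]) : Prop :=
  if (m < e)%N then forall k t s, f k t s = 0 else osc (m - e) r f.

Section ShiftedDegree.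
Context {R : realType}.
Implicit Types (f g : nat -> R -> R -> R[i]) (e r m : nat).

Lemma oscs_osc e r m f : oscs e r m f -> osc (m - e) r f.
Proof.
rewrite /oscs; case: ifP => // _ f0.
by apply: osc_ext (osc0 _ _) _ => k t s; rewrite f0.
Qed.

Lemma oscs_ext e r m f g : oscs e r m f -> (forall k t s, f k t s = g k t s) -> oscs e r m g.
Proof.
rewrite /oscs => Tf fg; case: ifP Tf => _ Tf; last exact: osc_ext Tf fg.
by move=> k t s; rewrite -fg.
Qed.

Lemma oscs_le e r r' m f : (r <= r')%N -> oscs e r m f -> oscs e r' m f.
Proof. by rewrite /oscs => rr'; case: ifP => // _; exact: osc_le. Qed.

Lemma oscs0 e r m : oscs e r m (fun _ _ _ => 0 : R[i]).
Proof. by rewrite /oscs; case: ifP => // _; exact: osc0. Qed.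

Lemma oscsD e r m f g : oscs e r m f -> oscs e r m g ->
  oscs e r m (fun k t s => f k t s + g k t s).
Proof.
rewrite /oscs; case: ifP => _; last exact: oscD.
by move=> f0 g0 k t s; rewrite f0 g0 addr0.
Qed.

Lemma oscs_mul X e r i m f : osc_mult X -> oscs e r m f ->
  oscs e r (i + m) (fun k t s => X i t s * f k t s).
Proof.
rewrite /oscs => MX Tf; case: (ltnP m e) Tf => [_ f0|em Tf].
  by case: ifP => _; [|apply: osc_ext (osc0 _ _) _] => k t s; rewrite f0 mulr0.
by rewrite ifF -?addnBA// ?ltnNge ?(leq_trans em) ?leq_addl//; exact: MX.
Qed.

Lemma oscs_mulrn e r m f n : oscs e r m f -> oscs e r m (fun k t s => f k t s *+ n).
Proof.
rewrite /oscs; case: ifP => _; last exact: osc_mulrn.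
by move=> f0 k t s; rewrite f0 mul0rn.
Qed.

Lemma oscs_sum e r m n (F : 'I_n -> nat -> R -> R -> R[i]) :
  (forall i, oscs e r m (F i)) -> oscs e r m (fun k t s => \sum_i F i k t s).
Proof.
move=> TF; elim: (index_enum _) => [|i l IHl].
  by apply: oscs_ext (oscs0 _ _ _) _ => k t s; rewrite big_nil.
by apply: oscs_ext (oscsD (TF i) IHl) _ => k t s; rewrite big_cons.
Qed.

Lemma oscs_dtheta e r m f : oscs e r m f -> oscs e r m (fun k => dtheta (f k)).
Proof.
rewrite /oscs; case: ifP => _; last exact: osc_dtheta.
move=> f0 k t s; rewrite /dtheta; under eq_fun do rewrite f0.
exact: (cderE (cder_cst _ _)).
Qed.

End ShiftedDegree.


(** A plain series seen as a family constant in [k], so that the rules for [osc] give its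
    differentiability and its form in [theta]. *)
Definition osc_series {R : realType} (phi : fseries R) : Prop :=
  forall m, osc m 1 (fun=> phi m).

(** * Diagonal part and linearity of the equation *)

Section Equation.
Context {R : realType}.
Implicit Types (phi psi : fseries R) (u : nae_input R).

(** Order [m] of the left-hand side without its diagonal part [l' (m^2 + d_theta^2) phi_m]; as the
    index of the coefficient starts at 1, only orders below [m] of [phi] occur. *)
Definition nae_low u phi m t s : R[i] :=
  (\sum_(i < m) serA u i.+1 t s * ser_rhod phi (m - i.+1)%N t s) *+ m +
  dtheta (fun t s => \sum_(i < m) serB u i.+1 t s * dtheta (phi (m - i.+1)%N) t s) t s.

Lemma dthetaE phi : ser_dtheta phi = fun m => dtheta (phi m).
Proof. by []. Qed.

Lemma dsE phi : ser_ds phi = fun m => ds (phi m).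
Proof. by []. Qed.

Lemma osc_series_mul X phi : osc_mult X -> osc_series phi -> osc_series (ser_mul X phi).
Proof.
move=> MX Tphi m; apply: osc_sum => i.
by have := MX i _ _ _ (Tphi (m - i)%N); rewrite subnKC// -ltnS.
Qed.

Lemma osc_series_dtheta phi : osc_series phi -> osc_series (ser_dtheta phi).
Proof. by move=> Tphi m; exact: osc_dtheta (Tphi m). Qed.

(** [osc_ds] returns the bound 2 on the order in [k]; freezing the index of a constant family brings
    it back to 1. *)
Lemma osc_series_ds phi : osc_series phi -> osc_series (ser_ds phi).
Proof. by move=> Tphi m; exact: osc_fix 0 (osc_ds (Tphi m)). Qed.

Lemma osc_seriesD phi psi : osc_series phi -> osc_series psi -> osc_series (ser_add phi psi).
Proof. by move=> Tphi Tpsi m; exact: oscD (Tphi m) (Tpsi m). Qed.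

Lemma osc_series_cst (a : R -> R) : smooth a -> osc_series (ser_cst a).
Proof.
move=> sa [|m]; last exact: osc0.
apply: osc_ext (@osc_cst R 0 0 0 (fun s => (a s)%:C) _ _ _) _ => //.
  exact: csmooth_real.
by move=> k t s; rewrite mulr0 subrr mul0r expi0 mulr1.
Qed.

Lemma osc_series_coef (c : nat -> nat -> R -> R[i]) :
  (forall m n, (n <= m)%N -> csmooth_per (c m n)) -> osc_series (ser_of_coef c).
Proof.
move=> sc m; apply: osc_sum => i; apply: osc_cst => //; first by rewrite -ltnS.
by apply: sc; rewrite -ltnS.
Qed.

Lemma nae_lhsE u phi m t s : admissible u -> osc_series phi ->
  nae_lhs u phi m t s =
    (speed u s)%:C * (phi m t s *+ m *+ m + dtheta (dtheta (phi m)) t s) +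
    nae_low u phi m t s.
Proof.
move=> hu Tphi; rewrite /nae_lhs {1}/ser_add /nae_low {1}/ser_rhod.
rewrite {1}/ser_mul big_ord_recl /= subn0 mulrnDl.
rewrite -[ser_dtheta _ _ _ _]/(dtheta (ser_mul (serB u) (ser_dtheta phi) m) t s).
have -> : ser_mul (serB u) (ser_dtheta phi) m =
    fun t s => (speed u s)%:C * dtheta (phi m) t s +
      \sum_(i < m) serB u i.+1 t s * dtheta (phi (m - i.+1)%N) t s.
  apply/funext => t'; apply/funext => s'.
  by rewrite /ser_mul big_ord_recl /= subn0 /serB /ser_add /= addr0.
have sl : csmooth_per (fun s => (speed u s)%:C) by exact: (csmooth_real (smooth_speed hu)).
have T1 := oscM sl (osc_dtheta (Tphi m)).
have T2 : osc m 1 (fun _ : nat => fun t s : R =>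
    \sum_(i < m) serB u i.+1 t s * dtheta (phi (m - i.+1)%N) t s).
  apply: osc_sum => i.
  by have := osc_mult_serB hu i.+1 (osc_dtheta (Tphi (m - i.+1)%N)); rewrite subnKC.
rewrite (dthetaD 0 t s T1 T2) addrACA; congr (_ + _).
have -> : dtheta (fun t s : R => (speed u s)%:C * dtheta (phi m) t s) t s =
   (speed u s)%:C * dtheta (dtheta (phi m)) t s.
  have := cderM (cder_cst (speed u s)%:C t) (osc_cder_t 0 t s (osc_dtheta (Tphi m))).
  by move/cderE; rewrite mul0r add0r.
rewrite [in RHS]mulrDr.
rewrite !mulrnAr. by [].
Qed.

Definition ser_lin (z : R[i]) phi psi : fseries R := fun m t s => phi m t s + z * psi m t s.

Lemma ser_mul_lin X z phi psi :
  ser_mul X (ser_lin z phi psi) = ser_lin z (ser_mul X phi) (ser_mul X psi).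
Proof.
apply/funext=> m; apply/funext=> t; apply/funext=> s.
rewrite /ser_mul /ser_lin mulr_sumr -big_split /=; apply: eq_bigr => i _; ring.
Qed.

Lemma ser_rhod_lin z phi psi :
  ser_rhod (ser_lin z phi psi) = ser_lin z (ser_rhod phi) (ser_rhod psi).
Proof.
apply/funext=> m; apply/funext=> t; apply/funext=> s.
by rewrite /ser_rhod /ser_lin mulrnDl mulrnAr.
Qed.

Lemma ser_dtheta_lin z phi psi : osc_series phi -> osc_series psi ->
  ser_dtheta (ser_lin z phi psi) = ser_lin z (ser_dtheta phi) (ser_dtheta psi).
Proof.
move=> Tphi Tpsi; apply/funext=> m; apply/funext=> t; apply/funext=> s.
rewrite /ser_lin; have Tm := Tpsi m; rewrite !dthetaE -(dthetaZ 0 t s z Tm).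
exact: (dthetaD 0 t s (Tphi m) (oscZ z Tm)).
Qed.

Lemma ser_ds_lin z phi psi : osc_series phi -> osc_series psi ->
  ser_ds (ser_lin z phi psi) = ser_lin z (ser_ds phi) (ser_ds psi).
Proof.
move=> Tphi Tpsi; apply/funext=> m; apply/funext=> t; apply/funext=> s.
rewrite /ser_lin; have Tm := Tpsi m; rewrite !dsE -(dsZ 0 t s z Tm).
exact: (dsD 0 t s (Tphi m) (oscZ z Tm)).
Qed.

Lemma nae_lhs_lin u z phi psi : admissible u -> osc_series phi -> osc_series psi ->
  nae_lhs u (ser_lin z phi psi) = ser_lin z (nae_lhs u phi) (nae_lhs u psi).
Proof.
move=> hu Tphi Tpsi; have MB := osc_mult_serB hu.
rewrite /nae_lhs !(ser_rhod_lin, ser_mul_lin) ser_dtheta_lin// ser_mul_lin.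
rewrite (ser_dtheta_lin z (osc_series_mul MB (osc_series_dtheta Tphi))
  (osc_series_mul MB (osc_series_dtheta Tpsi))).
apply/funext=> m; apply/funext=> t; apply/funext=> s.
by rewrite /ser_lin /ser_add mulrDr addrACA.
Qed.

(** The source [B_0 l'] makes the right-hand side affine in [phi]; it is linear in the pair
    [(phi, B_0)] for a given axis. *)
Lemma nae_rhs_lin u u1 u2 (e : R) phi psi : admissible u ->
  axis u1 = axis u -> axis u2 = axis u -> smooth (field0 u1) -> smooth (field0 u2) ->
  osc_series phi -> osc_series psi ->
  nae_rhs (NaeInput (axis u) (fun s => field0 u1 s + e * field0 u2 s) (mom_lo u) (mom_hi u))
    (ser_lin e%:C phi psi) = ser_lin e%:C (nae_rhs u1 phi) (nae_rhs u2 psi).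
Proof.
(* With the records opened, both axes become literally [axis u], and the coefficients built from the
   axis alone are convertible to those of [u]. *)
move: u1 u2 => [a1 b1 lo1 hi1] [a2 b2 lo2 hi2] hu /= -> -> sb1 sb2 Tphi Tpsi.
have sl := smooth_speed hu; have MC := osc_mult_serC hu; have MD := osc_mult_hsV hu.
rewrite /nae_rhs.
rewrite -[serC (NaeInput _ _ lo1 hi1)]/(serC u) -[serC (NaeInput _ _ lo2 hi2)]/(serC u).
rewrite -[serC (NaeInput _ _ _ _)]/(serC u).
rewrite -[serD (NaeInput _ _ lo1 hi1)]/(ser_hsV u) -[serD (NaeInput _ _ lo2 hi2)]/(ser_hsV u).
rewrite -[serD (NaeInput _ _ _ _)]/(ser_hsV u) /=.
set B1 := ser_cst (fun s => b1 s * speed (NaeInput _ b1 lo1 hi1) s).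
set B2 := ser_cst (fun s => b2 s * speed (NaeInput _ b2 lo2 hi2) s).
have T1 : osc_series B1 by exact: (osc_series_cst (smoothM _ sl)).
have T2 : osc_series B2 by exact: (osc_series_cst (smoothM _ sl)).
have -> : ser_add (ser_ds (ser_lin e%:C phi psi)) (ser_cst (fun s => (b1 s + e * b2 s) *
      speed (NaeInput (axis u) (fun s => b1 s + e * b2 s) (mom_lo u) (mom_hi u)) s)) =
    ser_lin e%:C (ser_add (ser_ds phi) B1) (ser_add (ser_ds psi) B2).
  rewrite ser_ds_lin//; apply/funext=> m; apply/funext=> t; apply/funext=> s.
  rewrite /ser_lin /ser_add /B1 /B2 /ser_cst.
  rewrite -[speed _ s]/(speed u s) -[speed _ s in X in _ = _ + X]/(speed u s).
  by case: m => [|m]; rewrite ?rmorphM ?rmorphD ?rmorphM /=; ring.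
have D1 := osc_seriesD (osc_series_ds Tphi) T1.
have D2 := osc_seriesD (osc_series_ds Tpsi) T2.
move: D1 D2; set d1 := ser_add _ B1; set d2 := ser_add _ B2 => D1 D2.
rewrite ser_dtheta_lin// !ser_mul_lin.
rewrite (ser_dtheta_lin _ (osc_series_mul MC D1) (osc_series_mul MC D2)).
rewrite (ser_ds_lin _ (osc_series_mul MD D1) (osc_series_mul MD D2)).
rewrite (ser_ds_lin _ (osc_series_mul MC (osc_series_dtheta Tphi))
  (osc_series_mul MC (osc_series_dtheta Tpsi))).
have aux (z a a' b b' c c' : R[i]) : - (a + z * a') + (- (b + z * b') - (c + z * c')) =
    - a + (- b - c) + z * (- a' + (- b' - c')) by ring.
apply/funext=> -[|[|m]]; apply/funext=> t; apply/funext=> s.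
- by rewrite /ser_lin /ser_rho2 mulr0 addr0.
- by rewrite /ser_lin /ser_rho2 mulr0 addr0.
- exact: aux.
Qed.

End Equation.

(** * Response to an oscillating on-axis field *)

(** Dependent choice along the whole history. By [Ploc] a value chosen for a truncated history
    remains valid for the full sequence. *)
Lemma course_of_values_choice (T : Type) (t0 : T) (P : nat -> (nat -> T) -> T -> Prop) :
  (forall m f g x, (forall j, (j < m)%N -> f j = g j) -> P m f x -> P m g x) ->
  (forall m f, (forall j, (j < m)%N -> P j f (f j)) -> exists x, P m f x) ->
  exists f, forall m, P m f (f m).
Proof.
move=> Ploc Pex.
(* Moving the condition on earlier values inside makes existence hold for every [f], so a choice
   function can be defined before any history is known to be good. *)
have Pch m f : exists x, (forall j, (j < m)%N -> P j f (f j)) -> P m f x.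
  have [H|H] := pselect (forall j, (j < m)%N -> P j f (f j)); last by exists t0.
  by have [x Px] := Pex m f H; exists x.
pose S m f := projT1 (cid (Pch m f)).
(* [h m] is the history of length [m]: the chosen values below [m], and the default [t0] from [m]
   on. *)
pose h := fix h m : nat -> T := if m is m'.+1 then
  (fun j => if j == m' then S m' (h m') else h m' j) else fun=> t0.
have hE m j : (j < m)%N -> h m j = S j (h j).
  elim: m => // m IHm; rewrite ltnS /= => jm; case: eqP => [->//|/eqP jNm].
  by apply: IHm; rewrite ltn_neqAle jNm.
exists (fun j => S j (h j)) => m.
have [n] := ubnP m; elim: n m => // n IHn m; rewrite ltnS => mn.
apply: (Ploc m (h m)) => [j|]; first exact: hE.
apply: (projT2 (cid (Pch m (h m)))) => j jm; rewrite (hE _ _ jm).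
apply: (Ploc j (fun j => S j (h j))) => [i ij|]; first by rewrite hE// (ltn_trans ij).
by apply: IHn; exact: leq_trans jm mn.
Qed.

Section LeadingTerm.
Context {R : realType}.
Implicit Types (u : nae_input R) (m k a : nat) (g : R -> R).

Definition wave a (x : R) g : nat -> R -> R -> R[i] := fun k _ s =>
  (k%:R ^+ a * cos (1%:R * k%:R * s + x))%:C * (g s)%:C.

(** A function independent of [theta] has frequency 0, which is among the [2 n - M] only for even
    [M]; an odd degree therefore forces [g = 0]. *)
Lemma osc_wave M r a x g : (a < r)%N -> smooth g -> (odd M -> forall s, g s = 0) ->
  osc M r (wave a x g).
Proof.
move=> ar sg g0; have [oM|eM] := boolP (odd M).
  by apply: osc_ext (osc0 _ _) _ => k t s; rewrite /wave g0// mulr0.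
have M2 : (M./2 <= M)%N by rewrite -{2}(odd_double_half M) -addnn addnA leq_addl.
apply: osc_ext (osc_gen 1 x ar M2 (csmooth_real sg)) _ => k t s.
rewrite (_ : (2 * (M./2)%:R - M%:R) = 0 :> R) ?mul0r ?expi0 ?mulr1//.
by rewrite -natrM mul2n even_halfK// subrr.
Qed.

Lemma ds_wave a x g k : smooth g -> ds (wave a x g k) =
  fun t s => wave a.+1 (x + pi / 2) g k t s + wave a x (derive1 g) k t s.
Proof.
move=> sg; apply/funext=> t; apply/funext=> s; rewrite /ds /wave.
have E1 := cderM (cder_cst ((k%:R : R) ^+ a)%:C s) (cder_cosD (1%:R * k%:R) x s).
have E2 : cder (fun s => (g s)%:C) s (derive1 g s)%:C.
  have := csmooth_cder s (csmooth_real sg); congr cder; apply: complex_ext => //=.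
  by rewrite derive1_cst.
have := cderM E1 E2; under eq_fun do rewrite -rmorphM /=.
move/cderE => ->; rewrite exprS !rmorphM /= !rmorph_nat addrA; ring.
Qed.

Lemma waveV a x g (h : R -> R) k t s :
  (h s)%:C * wave a x g k t s = wave a x (fun s => h s * g s) k t s.
Proof. by rewrite /wave mulrCA; congr (_ * _); rewrite -rmorphM. Qed.

Variable u : nae_input R.
Hypothesis hu : admissible u.

(* Coefficient of [k^(m-1) sin (k s)] in the order-[m] term of the response to
   [B_0 = cos (k s)]: each iteration of [- (1/l') d_s (1/l') d_s], divided by
   [m^2], gains two powers of [k]. *)
Fixpoint lead_amp m (s : R) : R :=
  match m with
  | 0%N | 1%N => 0
  | 2%N => (4 * speed u s)^-1
  | m'.+2 => lead_amp m' s * (m%:R ^+ 2 * speed u s ^+ 2)^-1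
  end.

Lemma lead_ampSS m s : lead_amp m.+3 s =
  lead_amp m.+1 s * (m.+3%:R ^+ 2 * speed u s ^+ 2)^-1.
Proof. by []. Qed.

Lemma nat_ind2 (P : nat -> Prop) : P 0%N -> P 1%N -> (forall m, P m -> P m.+2) -> forall m, P m.
Proof.
move=> P0 P1 PS m; suff [] : P m /\ P m.+1 by [].
by elim: m => [|m [Pm Pm1]]; split=> //; exact: PS.
Qed.

Lemma smooth_lead_amp m : smooth (lead_amp m).
Proof.
have sl := smooth_speed hu; have l0 := speed_neq0 hu.
elim/nat_ind2: m => [||[|m] IHm]; [exact: (smooth_cst 0)|exact: (smooth_cst 0)| |].
  apply: (smoothV _ (smoothM (smooth_cst 4) sl)) => s.
  by rewrite mulf_neq0// pnatr_eq0.
apply: (smoothM IHm); apply: (smoothV _ (smoothM (smooth_cst _) (smoothX 2 sl))) => s.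
by rewrite mulf_neq0// expf_neq0// pnatr_eq0.
Qed.

Lemma lead_amp_odd m s : odd m -> lead_amp m s = 0.
Proof.
elim/nat_ind2: m => // -[|m] IHm //; rewrite oddS oddS negbK => om.
by rewrite lead_ampSS IHm// mul0r.
Qed.

Lemma lead_amp_gt0 m s : ~~ odd m -> (1 < m)%N -> 0 < lead_amp m s.
Proof.
have l0 := speed_gt0 hu s.
elim/nat_ind2: m => // -[_ _ _|[//|m] IHm].
  by rewrite /= invr_gt0 mulr_gt0.
rewrite lead_ampSS oddS oddS negbK => om _.
by rewrite mulr_gt0 ?IHm// invr_gt0 mulr_gt0// exprn_gt0// ltr0n.
Qed.

(** The phase [- (pi / 2)] turns the cosine into [sin (k s)]. At [m = 0] the truncated exponent is
    harmless, the amplitude being zero. *)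
Definition lead m := wave m.-1 (- (pi / 2)) (lead_amp m).

Lemma oscs_lead m : oscs 2 m m (lead m).
Proof.
case: m => [|[|m]]; [by move=> k t s; rewrite /lead /wave mulr0..|].
have om : odd m -> forall s, lead_amp m.+2 s = 0.
  by move=> om s; apply: lead_amp_odd; rewrite oddS oddS negbK.
rewrite /oscs subSS subSS subn0.
exact: (osc_wave _ (ltnSn m.+1) (smooth_lead_amp m.+2) om).
Qed.

Lemma lead_flat m k t s : dtheta (dtheta (lead m k)) t s = 0.
Proof.
have E (f : R -> R[i]) : dtheta (fun _ s => f s) = fun _ _ : R => 0.
  by apply/funext=> t'; apply/funext => s'; rewrite /dtheta (cderE (cder_cst _ _)).
by rewrite E [in LHS](E (fun=> 0)).
Qed.

End LeadingTerm.

Section Locality.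
Context {R : realType}.
Implicit Types (u : nae_input R) (phi psi : fseries R).

Lemma nae_low_local u phi psi m : (forall j, (j < m)%N -> phi j = psi j) ->
  nae_low u phi m = nae_low u psi m.
Proof.
move=> E; apply/funext=> t; apply/funext=> s; rewrite /nae_low.
have im (i : 'I_m) : (m - i.+1 < m)%N by rewrite ltn_subrL (leq_trans _ (ltn_ord i)).
congr (_ *+ m + dtheta _ t s).
  by apply: eq_bigr => i _; rewrite /ser_rhod E.
by apply/funext=> t'; apply/funext=> s'; apply: eq_bigr => i _; rewrite E.
Qed.

Lemma ser_mul_local X phi psi m : (forall j, (j <= m)%N -> phi j = psi j) ->
  ser_mul X phi m = ser_mul X psi m.
Proof.
move=> E; apply/funext=> t; apply/funext=> s; apply: eq_bigr => i _.
by rewrite E// leq_subr.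
Qed.

Lemma nae_rhs_local u phi psi m : (forall j, (j < m)%N -> phi j = psi j) ->
  nae_rhs u phi m = nae_rhs u psi m.
Proof.
case: m => [|[|m]] E; [by []|by []|].
have {}E j : (j <= m)%N -> phi j = psi j.
  by move=> jm; apply: E; rewrite ltnS leqW.
pose b := ser_cst (fun s => field0 u s * speed u s).
have E1 j : (j <= m)%N -> ser_add (ser_ds phi) b j = ser_add (ser_ds psi) b j.
  by move=> jm; rewrite /ser_add /ser_ds E.
have E2 j : (j <= m)%N -> ser_dtheta phi j = ser_dtheta psi j.
  by move=> jm; rewrite /ser_dtheta E.
have H f : nae_rhs u f m.+2 = fun t s =>
    - dtheta (ser_mul (serC u) (ser_add (ser_ds f) b) m) t s +
    (- ds (ser_mul (serC u) (ser_dtheta f) m) t s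
     - ds (ser_mul (serD u) (ser_add (ser_ds f) b) m) t s) by [].
rewrite (H phi) (H psi) (ser_mul_local (serC u) E1) (ser_mul_local (serD u) E1).
by rewrite (ser_mul_local (serC u) E2).
Qed.

End Locality.

Section Response.
Context {R : realType}.
Variable u : nae_input R.
Hypothesis hu : admissible u.
Implicit Types (Phi : nat -> nat -> R -> R -> R[i]) (m k : nat).

Definition wave_input k : nae_input R :=
  NaeInput (axis u) (fun s => cos (k%:R * s)) (fun _ _ => 0) (fun _ _ => 0).

Let mulrn_mulrn (x : R) n : x%:C *+ n *+ n = (x * n%:R ^+ 2)%:C.
Proof. by rewrite expr2 -natrM mulr_natr mulrnA !rmorphMn. Qed.

(** Order [j] of [d_s phi + B_0 l'], on which both [C] and [D] act; the on-axis field enters at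
    [j = 0] only. *)
Let dB Phi j k t s : R[i] :=
  ds (Phi j k) t s + ser_cst (fun s => cos (k%:R * s) * speed u s) j t s.

(** The invariant of the recursion: degree [m - 2] in [theta], and agreement with the leading term
    up to powers of [k] below [m - 1]. For [m < 2] it forces [g = 0]. *)
Let rem m g := oscs 2 m.-1 m (fun k t s => g k t s - lead u m k t s).

Let rem_oscs m g : rem m g -> oscs 2 m m g.
Proof.
move=> Tg; apply: oscs_ext (oscsD (oscs_le (leq_pred m) Tg) (oscs_lead hu m)) _ => k t s.
by rewrite subrK.
Qed.

Let rem_osc m g : rem m g -> osc m m g.
Proof.
move=> /rem_oscs; rewrite /oscs; case: ltnP => [_ g0|m2 Tg].
  by apply: osc_ext (osc0 _ _) _ => k t s; rewrite g0.
by have := osc_raise Tg; rewrite -addn2 subnK.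
Qed.

Let osc_dB Phi m : rem m (Phi m) -> osc m m.+1 (dB Phi m).
Proof.
move=> TP; apply: oscD; first exact: osc_ds (rem_osc TP).
case: m TP => [|m] _; last exact: osc0.
have := @osc_gen R 0 1 0 0 1 0 _ (ltn0Sn 0) (leqnn 0) (csmooth_real (smooth_speed hu)).
move/osc_ext; apply=> k t s; rewrite /ser_cst expr0 mulr0 subrr mul0r expi0 mulr1 !mul1r addr0.
by rewrite [in RHS]rmorphM.
Qed.

(** The only place where the top power of [k] appears. The recurrence of [lead_amp] is the one for
    which it cancels. *)
Let ds_hsV_dB Phi m : rem m (Phi m) ->
  osc m m.+1 (fun k t s => ds (fun t s => serD u 0 t s * dB Phi m k t s) t s +
    (speed u s)%:C * (lead u m.+2 k t s *+ m.+2 *+ m.+2)).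
Proof.
move=> TP; have sl := smooth_speed hu; have l0 := speed_neq0 hu.
have sV := smoothV l0 sl.
case: m TP => [|m] TP.
  (* Start of the chain: [Phi 0 = 0] and [D_0 l' = 1] leave [cos (k s)] under the derivative, and
     the cancellation is exact. *)
  apply: osc_ext (osc0 _ _) _ => k t s.
  have -> : (fun t s => serD u 0 t s * dB Phi 0 k t s) = wave 0 0 (fun=> 1) k.
    apply/funext=> t'; apply/funext=> s'.
    have P0 : Phi 0%N k = fun _ _ => 0.
      by apply/funext=> t1; apply/funext=> s1; have := TP k t1 s1; rewrite /lead /wave mulr0 subr0.
    rewrite /dB P0 /ds (cderE (cder_cst _ _)) add0r /serD /ser_hsV !expr0 mulr1.
    rewrite /wave /ser_cst expr0 !mul1r addr0 mulr1 -rmorphM /=; congr (_%:C).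
    by rewrite mulrCA mulVf// mulr1.
  rewrite (ds_wave _ _ _ (smooth_cst 1)).
  rewrite /lead /wave derive1_cst mulr0 addr0 -!rmorphM mulrn_mulrn -rmorphM -rmorphD.
  rewrite -[LHS]/(0%:C); congr (_%:C) => /=.
  rewrite add0r cosDpihalf cosBpihalf; have := l0 s => ls0.
  by field.
have sG := smooth_lead_amp hu m.+1; set G := lead_amp u m.+1 in sG.
have sG' := smooth_derive1 sG.
pose rest k t s := Phi m.+1 k t s - lead u m.+1 k t s.
have Trest : osc m.+1 m rest.
  move: TP; rewrite /rem /oscs /=; case: ifP => [_ r0|/negbT]; last first.
    rewrite -leqNgt => m2 Tr; have := osc_raise Tr; rewrite -addn2 subnK//.
  by apply: osc_ext (osc0 _ _) _ => k t s; rewrite /rest r0.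
have podd (h : R -> R) : odd m.+1 -> forall s, h s * G s = 0.
  by move=> om s; rewrite /G lead_amp_odd ?mulr0.
have podd' : odd m.+1 -> forall s, derive1 G s = 0.
  move=> om s; rewrite (_ : G = cst 0) ?derive1_cst//.
  by apply/funext => s'; rewrite /G lead_amp_odd.
pose Vl s := (speed u s)^-1.
(* [w1] carries the top power, to be cancelled after differentiation. [w2] and the term in [rest]
   are one power lower, and their derivatives stay within the claimed bound. *)
pose w1 := wave m.+1 0 (fun s => Vl s * G s).
pose w2 := wave m (- (pi / 2)) (fun s => Vl s * derive1 G s).
have Tw2 : osc m.+1 m.+1 w2.
  have p0 : odd m.+1 -> forall s, Vl s * derive1 G s = 0 by move=> om s; rewrite podd' ?mulr0.
  exact: (osc_wave _ (ltnSn m) (smoothM sV sG') p0).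
have Tw1 : osc m.+1 m.+2 w1 by exact: (osc_wave _ (ltnSn m.+1) (smoothM sV sG) (podd Vl)).
have Tr : osc m.+1 m.+1 (fun k t s => (Vl s)%:C * ds (rest k) t s).
  exact: (oscM (csmooth_real sV) (osc_ds Trest)).
have E k : (fun t s => serD u 0 t s * dB Phi m.+1 k t s) =
    fun t s => w1 k t s + (w2 k t s + (Vl s)%:C * ds (rest k) t s).
  apply/funext=> t; apply/funext=> s.
  have -> : dB Phi m.+1 k t s = ds (lead u m.+1 k) t s + ds (rest k) t s.
    rewrite /dB /ser_cst addr0.
    rewrite -(dsD k t s (oscs_osc (oscs_lead hu m.+1)) Trest).
    congr (ds _ t s); apply/funext => t'; apply/funext=> s'.
    by rewrite /rest addrC subrK.
  rewrite /lead (ds_wave _ _ _ sG) /serD /ser_hsV expr0 mulr1 addNr !mulrDr.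
  rewrite -[(speed u s)^-1]/(Vl s) !(waveV _ _ _ Vl).
  by rewrite addrA.
have sVG' := smooth_derive1 (smoothM sV sG).
have Tend : osc m.+1 m.+2 (fun k t s => wave m.+1 0 (derive1 (fun s => Vl s * G s)) k t s +
    ds (fun t s => w2 k t s + (Vl s)%:C * ds (rest k) t s) t s).
  apply: oscD; last exact: osc_ds (oscD Tw2 Tr).
  apply: (osc_wave _ (ltnSn m.+1) sVG') => om s.
  rewrite (_ : (fun s => Vl s * G s) = cst 0) ?derive1_cst//.
  by apply/funext => s'; rewrite podd.
apply: osc_ext Tend _ => k t s; rewrite E (dsD k t s Tw1 (oscD Tw2 Tr)).
rewrite (ds_wave _ _ _ (smoothM sV sG)) addrAC; congr (_ + _).
rewrite -[LHS]add0r addrAC; congr (_ + _).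
rewrite /lead /wave add0r -!rmorphM mulrn_mulrn -rmorphM -rmorphD.
rewrite -[LHS]/(0%:C); congr (_%:C).
rewrite cosDpihalf cosBpihalf lead_ampSS -/G /Vl -[m.+3.-1]/m.+2.
by have := l0 s => ls0; field; rewrite ls0 -natrD pnatr_eq0.
Qed.

(** Every term pairs a coefficient with a strictly earlier [Phi], and no derivative in [s] is taken,
    so the power of [k] lost by going back is never regained. *)
Let low_oscs Phi m : (forall j, (j < m)%N -> rem j (Phi j)) ->
  oscs 2 m.-1 m (fun k => nae_low u (fun j => Phi j k) m).
Proof.
move=> TP.
have H (X : fseries R) (op : (R -> R -> R[i]) -> R -> R -> R[i]) (i : 'I_m) : osc_mult X ->
    (forall r j f, oscs 2 r j f -> oscs 2 r j (fun k => op (f k))) ->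
    oscs 2 m.-1 m (fun k t s => X i.+1 t s * op (Phi (m - i.+1)%N k) t s).
  move=> MX Hop; have im : (m - i.+1 < m)%N by rewrite ltn_subrL (leq_trans _ (ltn_ord i)).
  have := oscs_mul i.+1 MX (Hop _ _ _ (rem_oscs (TP _ im))); rewrite subnKC//.
  by apply: oscs_le; rewrite -ltnS prednK// (leq_trans _ (ltn_ord i)).
apply: oscsD.
  apply/oscs_mulrn/oscs_sum => i.
  apply: (H _ (fun f t s => f t s *+ (m - i.+1))); first exact: osc_mult_hs.
  by move=> r j f; exact: oscs_mulrn.
apply/oscs_dtheta/oscs_sum => i.
apply: H; first exact: osc_mult_serB.
by move=> r j f; exact: oscs_dtheta.
Qed.

(** The terms in [C] contain a single derivative in [s]; those in [D_i] with [i >= 1] contain two,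
    but act on earlier orders. Only [D_0] reaches the top power. *)
Let rhs_osc Phi m : (forall j, (j < m.+2)%N -> rem j (Phi j)) ->
  osc m m.+1 (fun k t s => nae_rhs (wave_input k) (fun j => Phi j k) m.+2 t s -
    (speed u s)%:C * (lead u m.+2 k t s *+ m.+2 *+ m.+2)).
Proof.
move=> TP.
have TB i : (i < m.+1)%N -> osc (m - i) m.+1 (dB Phi (m - i)).
  move=> im; have mi : (m - i <= m)%N by exact: leq_subr.
  by apply: osc_le (osc_dB (TP _ _)) => //; exact: leqW.
have T1 : osc m m.+1 (fun k => dtheta (fun t s =>
    \sum_(i < m.+1) serC u i t s * dB Phi (m - i)%N k t s)).
  apply/osc_dtheta/osc_sum => i; have im := ltn_ord i.
  by have := osc_mult_serC hu i (TB _ im); rewrite subnKC.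
have T2 : osc m m.+1 (fun k => ds (fun t s =>
    \sum_(i < m.+1) serC u i t s * dtheta (Phi (m - i)%N k) t s)).
  apply/osc_ds/osc_sum => i; have im := ltn_ord i.
  have mi : (m - i <= m)%N by exact: leq_subr.
  have TPi := osc_le mi (rem_osc (TP _ (leq_ltn_trans mi (leqW (ltnSn m))))).
  by have := osc_mult_serC hu i (osc_dtheta TPi); rewrite subnKC.
have Trest : osc m m (fun k t s => \sum_(i < m) serD u i.+1 t s * dB Phi (m - i.+1)%N k t s).
  apply: osc_sum => i; have im := ltn_ord i.
  have mi : (m - i.+1 < m)%N by rewrite ltn_subrL (leq_trans _ im).
  have := osc_mult_hsV hu i.+1 (osc_le mi (osc_dB (TP _ (leq_trans mi (leqW (leqnSn m)))))).
  by rewrite subnKC.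
have T0 : osc m m.+1 (fun k t s => serD u 0 t s * dB Phi m k t s).
  exact: (osc_mult_hsV hu 0 (osc_dB (TP m (leqW (ltnSn m))))).
have T3 := ds_hsV_dB (TP m (leqW (ltnSn m))).
apply: osc_ext (oscN (oscD T1 (oscD T2 (oscD T3 (osc_ds Trest))))) _ => k t s.
rewrite -[nae_rhs _ _ _ _ _]/(- dtheta (fun t s =>
      \sum_(i < m.+1) serC u i t s * dB Phi (m - i)%N k t s) t s +
    (- ds (fun t s => \sum_(i < m.+1) serC u i t s * dtheta (Phi (m - i)%N k) t s) t s
     - ds (fun t s => \sum_(i < m.+1) serD u i t s * dB Phi (m - i)%N k t s) t s)).
have -> : (fun t s => \sum_(i < m.+1) serD u i t s * dB Phi (m - i)%N k t s) =
    fun t s => serD u 0 t s * dB Phi m k t s +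
      \sum_(i < m) serD u i.+1 t s * dB Phi (m - i.+1)%N k t s.
  by apply/funext=> t'; apply/funext=> s'; rewrite big_ord_recl subn0.
rewrite (dsD k t s T0 Trest).
have aux (a b c d e : R[i]) : - (a + (b + (c + e + d))) = - a + (- b - (c + d)) - e by ring.
exact: aux.
Qed.

Let response_step m Phi : (forall j, (j < m)%N -> rem j (Phi j)) ->
  exists g, rem m g /\ forall k t s,
    (speed u s)%:C * (g k t s *+ m *+ m + dtheta (dtheta (g k)) t s) +
      nae_low u (fun j => Phi j k) m t s = nae_rhs (wave_input k) (fun j => Phi j k) m t s.
Proof.
move=> TP; have TL := low_oscs TP.
(* At orders 0 and 1 the response is the prescribed zero, and both sides of the equation vanish. *)
have Z (n : nat) : (n < 2)%N -> n = m -> exists g, rem m g /\ forall k t s,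
    (speed u s)%:C * (g k t s *+ m *+ m + dtheta (dtheta (g k)) t s) +
      nae_low u (fun j => Phi j k) m t s = nae_rhs (wave_input k) (fun j => Phi j k) m t s.
  move=> n2 nm; rewrite nm in n2; exists (fun _ _ _ => 0); split.
    rewrite /rem /oscs n2 => k t s.
    by case: (m) n2 => [|[|//]] _; rewrite /lead /wave mulr0 subr0.
  move: TL; rewrite /oscs n2 => TL0 k t s; rewrite [X in _ + X]TL0 !mul0rn add0r.
  have -> : dtheta (fun _ _ : R => 0 : R[i]) = fun _ _ => 0.
    by apply/funext=> t'; apply/funext=> s'; rewrite /dtheta (cderE (cder_cst _ _)).
  rewrite /dtheta (cderE (cder_cst _ _)) mulr0 addr0.
  by case: (m) n2 => [|[|]].
case: m TP TL Z => [|[|m]] TP TL Z; [exact: (Z 0%N)|exact: (Z 1%N)|].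
have TL' : osc m m.+1 (fun k => nae_low u (fun j => Phi j k) m.+2).
  by have := oscs_osc TL; rewrite subSS subSS subn0.
(* The unknown is the remainder, not [Phi] itself: since [lead] is free of [theta], the operator
   acts on it as [m^2], and subtracting it removes the top power of [k] from the source. *)
have [g Tg Eg] := osc_inv (erefl m.+2) (speed_neq0 hu) (smooth_speed hu)
  (oscB (rhs_osc TP) TL').
exists (fun k t s => g k t s + lead u m.+2 k t s); split.
  rewrite /rem /oscs /= subSS subSS subn0; apply: osc_ext Tg _ => k t s.
  by rewrite addrK.
move=> k t s; have := Eg k t s.
have Tlead := oscs_osc (oscs_lead hu m.+2).
have -> : dtheta (fun t s => g k t s + lead u m.+2 k t s) =
    fun t s => dtheta (g k) t s + dtheta (lead u m.+2 k) t s.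
  by apply/funext=> t'; apply/funext=> s'; rewrite (dthetaD k t' s' Tg Tlead).
rewrite (dthetaD k t s (osc_dtheta Tg) (osc_dtheta Tlead)) lead_flat addr0.
have aux (l a a' b c d e : R[i]) : l * (a + b) = d - l * a' - c -> l * (a + a' + b) + c = d.
  by move=> H; have -> : l * (a + a' + b) = l * (a + b) + l * a' by [ring]; rewrite H; ring.
have aux2 (n : nat) (x y : R[i]) : (x + y) *+ n *+ n = x *+ n *+ n + y *+ n *+ n.
  by rewrite !mulrnDl.
by move=> H; rewrite aux2; exact: aux H.
Qed.

(** The equations are solved for all [k] at once, as one family; this is what makes the bounds on
    the remainder uniform in [k]. *)
Lemma response : exists Phi,
  (forall m, oscs 2 m m (Phi m)) /\
  (forall m, oscs 2 m.-1 m (fun k t s => Phi m k t s - lead u m k t s)) /\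
  forall k m t s, nae_lhs u (fun j => Phi j k) m t s =
                  nae_rhs (wave_input k) (fun j => Phi j k) m t s.
Proof.
have [||Phi HPhi] := @course_of_values_choice (nat -> R -> R -> R[i]) (fun _ _ _ => 0)
  (fun m Phi g => rem m g /\ forall k t s,
    (speed u s)%:C * (g k t s *+ m *+ m + dtheta (dtheta (g k)) t s) +
      nae_low u (fun j => Phi j k) m t s = nae_rhs (wave_input k) (fun j => Phi j k) m t s).
- move=> m f g x fg [rx Ex]; split; first exact: rx.
  move=> k t s.
  have E j : (j < m)%N -> g j k = f j k by move=> jm; rewrite fg.
  rewrite (@nae_low_local R u (fun j => g j k) (fun j => f j k) m E).
  rewrite (@nae_rhs_local R (wave_input k) (fun j => g j k) (fun j => f j k) m E).
  exact: Ex.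
- by move=> m f Hf; apply: response_step => j jm; case: (Hf j jm).
exists Phi; split=> [m|]; first by apply: rem_oscs; case: (HPhi m).
split=> [m|k m t s]; first by case: (HPhi m).
have [_ <-] := HPhi m; apply: nae_lhsE => // j.
have [/rem_osc TPj _] := HPhi j; exact: osc_fix k TPj.
Qed.


End Response.

(** * Uniqueness and superposition *)

Section Uniqueness.
Context {R : realType}.
Implicit Types (u : nae_input R) (phi psi : fseries R).

Lemma expiX (x : R) n : expi x ^+ n = expi (n%:R * x).
Proof.
elim: n => [|n IHn]; first by rewrite mul0r expi0.
by rewrite exprS IHn -expiD -natr1 mulrDl mul1r addrC.
Qed.

(** Multiplied by [e^(i m t)], the sum becomes a polynomial of degree at most [m] in [e^(2 i t)],
    and it has more than [m] roots. *)
Lemma trig_poly_eq0 m (a : nat -> R[i]) :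
  (forall t : R, \sum_(n < m.+1) a n * expi ((2 * n%:R - m%:R) * t) = 0) ->
  forall n, (n <= m)%N -> a n = 0.
Proof.
move=> a0; pose p := \poly_(n < m.+1) a n.
(* Points of the unit circle with angles in [[0, pi]], where the cosine is injective and so tells
   them apart. *)
pose x (i : nat) : R[i] := expi (pi / i.+1%:R).
have px i : p.[x i] = 0.
  have -> : x i = expi (2 * (pi / i.+1%:R / 2)) by rewrite mulrC divfK ?pnatr_eq0.
  set y := pi / i.+1%:R / 2; rewrite horner_poly.
  transitivity (expi (m%:R * y) * \sum_(n < m.+1) a n * expi ((2 * n%:R - m%:R) * y)).
    rewrite mulr_sumr; apply: eq_bigr => n _.
    by rewrite expiX [RHS]mulrCA -expiD; congr (_ * expi _); ring.
  by rewrite a0 mulr0.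
have p0 : p = 0.
  apply: (@roots_geq_poly_eq0 _ p [seq x i | i <- iota 0 m.+1]).
  - by apply/allP => _ /mapP[i _ ->]; rewrite rootE px.
  - rewrite map_inj_in_uniq ?iota_uniq// => i j _ _ [cij _].
    have piI (n : nat) : (pi / n.+1%:R : R) \in `[0, pi]%R.
      rewrite in_itv /= divr_ge0 ?pi_ge0//= ler_pdivrMr ?ltr0n//.
      by rewrite ler_peMr ?pi_ge0// ler1n.
    have := cos_inj (piI i) (piI j) cij.
    have p0 : pi != 0 :> R by rewrite gt_eqF// pi_gt0.
    by move/(mulfI p0)/invr_inj/eqP; rewrite eqr_nat eqSS => /eqP.
  - by rewrite size_map size_iota size_poly.
by move=> n nm; have := congr1 (fun q : {poly R[i]} => q`_n) p0; rewrite coef_poly coef0 ltnS nm.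
Qed.

Lemma cder_sum n (F : 'I_n -> R -> R[i]) x (d : 'I_n -> R[i]) :
  (forall i, cder (F i) x (d i)) -> cder (fun y => \sum_i F i y) x (\sum_i d i).
Proof.
move=> HF; elim: (index_enum _) => [|i l IHl].
  by under eq_fun do rewrite big_nil; rewrite big_nil; exact: cder_cst.
by under eq_fun do rewrite big_cons; rewrite big_cons; exact: cderD.
Qed.

Lemma dtheta_sum n (c : 'I_n -> R -> R[i]) (j : 'I_n -> R) :
  dtheta (fun t s => \sum_i c i s * expi (j i * t)) =
  fun t s => \sum_i ((0 +i* j i) * c i s) * expi (j i * t).
Proof.
apply/funext=> t; apply/funext=> s.
apply: etrans (cderE (cder_sum (fun i => cderM (cder_cst (c i s) t) (cder_expi (j i) t)))) _.
by apply: eq_bigr => i _; ring.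
Qed.

Lemma nae_solution_osc u psi : nae_solution u psi -> osc_series psi.
Proof. by move=> [c [-> sc _ _ _]]; exact: osc_series_coef. Qed.

(** If all earlier orders agree, the difference at order [m] is annihilated by [m^2 + d_theta^2].
    Its symbol [4 k (m - k)] vanishes only at the two extreme coefficients, which are prescribed. *)
Lemma nae_solution_unique u psi psi' : admissible u ->
  nae_solution u psi -> nae_solution u psi' -> psi = psi'.
Proof.
move=> hu Hpsi Hpsi'; have Tpsi := nae_solution_osc Hpsi.
have Tpsi' := nae_solution_osc Hpsi'.
move: Hpsi Hpsi' => [c [Ec sc c0 cm eqc]] [c' [Ec' sc' c'0 c'm eqc']].
apply/funext => m; have [n] := ubnP m; elim: n m => // n IHn m; rewrite ltnS => mn.
have {}IHn j : (j < m)%N -> psi j = psi' j by move=> jm; apply: IHn; exact: leq_trans jm mn.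
have EL := nae_low_local u IHn; have ER := nae_rhs_local u IHn.
have Eop t s : psi m t s *+ m *+ m + dtheta (dtheta (psi m)) t s =
    psi' m t s *+ m *+ m + dtheta (dtheta (psi' m)) t s.
  have := eqc m t s; rewrite (nae_lhsE m t s hu Tpsi) EL ER -eqc' (nae_lhsE m t s hu Tpsi').
  move/addIr/mulfI; apply.
  by rewrite fmorph_eq0 speed_neq0.
have Hop (b : nat -> nat -> R -> R[i]) t s : ser_of_coef b m t s *+ m *+ m +
      dtheta (dtheta (ser_of_coef b m)) t s =
    \sum_(n < m.+1) ((m%:R ^+ 2 - (2 * n%:R - m%:R) ^+ 2)%:C * b m n s) *
      expi ((2 * n%:R - m%:R) * t).
  rewrite /ser_of_coef dtheta_sum (dtheta_sum (fun i s => (0 +i* _) * b m i s)).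
  have mm (x : R[i]) : x *+ m *+ m = (m%:R ^+ 2)%:C * x.
    by rewrite -mulrnA -[LHS]mulr_natl natrM -expr2 rmorphXn /= rmorph_nat.
  rewrite mm mulr_sumr -big_split /=; apply: eq_bigr => i _.
  set j := 2 * _ - _; have -> : (m%:R ^+ 2 - j ^+ 2)%:C = (m%:R ^+ 2)%:C + (0 +i* j) * (0 +i* j).
    by apply: complex_ext; rewrite ?Re_add ?Im_add ?Re_mul ?Im_mul /=; ring.
  by ring.
have Ecc k s : (k <= m)%N -> c m k s = c' m k s.
  move=> km; have := @trig_poly_eq0 m
    (fun n => (m%:R ^+ 2 - (2 * n%:R - m%:R) ^+ 2)%:C * (c m n s - c' m n s)) _ k km.
  have [k0|k0] := eqVneq k 0%N.
    move=> _; rewrite k0; case: (m) cm c'm c0 c'0 => [|[|p]] cm c'm c0 c'0.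
    - by have [-> _ _] := c0 s; have [-> _ _] := c'0 s.
    - by have [_ -> _] := c0 s; have [_ -> _] := c'0 s.
    - have [-> _] := cm p.+2 s isT; by have [-> _] := c'm p.+2 s isT.
  have [kE|kNm] := eqVneq k m.
    move=> _; rewrite kE; case: (m) cm c'm c0 c'0 => [|[|p]] cm c'm c0 c'0.
    - by have [-> _ _] := c0 s; have [-> _ _] := c'0 s.
    - by have [_ _ ->] := c0 s; have [_ _ ->] := c'0 s.
    - have [_ ->] := cm p.+2 s isT; by have [_ ->] := c'm p.+2 s isT.
  move=> H; apply/eqP; rewrite -subr_eq0.
  have {}H : (m%:R ^+ 2 - (2 * k%:R - m%:R) ^+ 2)%:C * (c m k s - c' m k s) = 0.
    apply: H => t; have := Eop t s; rewrite Ec Ec' !Hop => /eqP.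
    rewrite -subr_eq0 -sumrB => /eqP E; rewrite -[RHS]E; apply: eq_bigr => i _.
    by rewrite mulrBr mulrBl.
  move/eqP: H; rewrite mulf_eq0 => /orP[|//].
  rewrite fmorph_eq0.
  have -> : m%:R ^+ 2 - (2 * k%:R - m%:R) ^+ 2 = (4 * k * (m - k))%:R :> R.
    rewrite natrM natrM.
    rewrite (natrB _ km).
    by ring.
  by rewrite pnatr_eq0 !muln_eq0 (negPf k0) /= subn_eq0 leqNgt ltn_neqAle kNm km.
apply/funext=> t; apply/funext=> s; rewrite Ec Ec'; apply: eq_bigr => i _.
have im : (i <= m)%N by rewrite -ltnS.
by rewrite (Ecc i s im).
Qed.

End Uniqueness.

Section Combination.
Context {R : realType}.
Implicit Types (u : nae_input R) (phi : fseries R).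

Definition field_wave (e : R) (k : nat) : nae_input R :=
  NaeInput (fun=> 0) (fun s => e * cos (k%:R * s)) (fun _ _ => 0) (fun _ _ => 0).

Lemma add_field_wave u e k : add_input u (field_wave e k) =
  NaeInput (axis u) (fun s => field0 u s + e * field0 (wave_input u k) s) (mom_lo u) (mom_hi u).
Proof.
rewrite /add_input /=; congr NaeInput.
- by apply/funext => s; rewrite addr0.
- by apply/funext => m; apply/funext => s; rewrite addr0.
- by apply/funext => m; apply/funext => s; rewrite addr0.
Qed.

Lemma smooth_cos_wave (k : nat) : smooth (fun s : R => cos (k%:R * s)).
Proof.
have := smooth_cosD 1 k (0 : R); congr smooth_per; apply/funext => s.
by rewrite mul1r addr0.
Qed.

(** Degree [m - 2] is read as degree [m]: indices shift by one and both extreme coefficients are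
    zero. Hence the response does not touch the input moments. *)
Lemma oscs2_coef m r f k : oscs 2 r m f -> exists c : nat -> R -> R[i],
  [/\ forall n, csmooth_per (c n), forall s, c 0%N s = 0, forall s, c m s = 0 &
  forall t s, f k t s = \sum_(n < m.+1) c n s * expi ((2 * n%:R - m%:R) * t)].
Proof.
rewrite /oscs; case: ltnP => [_ f0|].
  exists (fun _ _ => 0); split=> // [n|t s]; first exact: csmooth_cst.
  by rewrite f0 big1// => i _; rewrite mul0r.
case: m => [|[|m]]// _; rewrite subSS subSS subn0 => /(osc_coef k)[c sc Ec].
exists (fun n s => if n is n'.+1 then (if (n' <= m)%N then c n' s else 0) else 0); split=> //.
- by case=> [|n]; [exact: csmooth_cst|case: leqP => _ //; exact: csmooth_cst].
- by move=> s; rewrite ltnn.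
- move=> t s; rewrite Ec [RHS]big_ord_recl /= mul0r add0r [RHS]big_ord_recr /= ltnn mul0r addr0.
  apply: eq_bigr => i _; rewrite -ltnS ltn_ord -natr1 -[m.+2%:R]natr1 -[m.+1%:R]natr1.
  by congr (_ * expi _); rewrite /bump /= add1n -natr1; ring.
Qed.

(** Superposition. It yields both the formula for the perturbed solution and the existence of
    one. *)
Lemma nae_solution_field_wave u phi Phi (e : R) k : admissible u -> nae_solution u phi ->
  (forall m, oscs 2 m m (Phi m)) ->
  (forall m t s, nae_lhs u (fun j => Phi j k) m t s =
                 nae_rhs (wave_input u k) (fun j => Phi j k) m t s) ->
  nae_solution (add_input u (field_wave e k)) (ser_lin e%:C phi (fun j => Phi j k)).
Proof.
move=> hu Hphi TPhi EPhi; have Tphi := nae_solution_osc Hphi.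
have TPk : osc_series (fun j => Phi j k).
  move=> m; apply: (osc_fix k); have := TPhi m; rewrite /oscs; case: ltnP => [_ f0|m2 Tm].
    by apply: osc_ext (osc0 _ m) _ => k' t s; rewrite f0.
  by have := osc_raise Tm; rewrite -addn2 subnK.
have [sa sb _] := hu.1.
have [D HD] := choice (fun m => oscs2_coef k (TPhi m)).
rewrite add_field_wave; move: Hphi => [c [Ec sc c0 cm eqc]].
exists (fun m n s => c m n s + e%:C * D m n s); split.
- apply/funext=> m; apply/funext=> t; apply/funext=> s; rewrite /ser_lin Ec /ser_of_coef.
  have [_ _ _ ->] := HD m; rewrite mulr_sumr -big_split /=; apply: eq_bigr => i _; ring.
- move=> m n nm; apply: csmoothD; first exact: sc.
  by apply: csmoothM; [exact: csmooth_cst|have [+ _ _ _] := HD m; exact].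
- move=> s; have [-> -> ->] := c0 s.
  have [_ H00 _ _] := HD 0%N; have [_ H10 H11 _] := HD 1%N.
  by rewrite H00 H10 H11 mulr0 addr0.
- move=> m s m2; have [-> ->] := cm m s m2; have [_ Hm0 Hmm _] := HD m.
  by rewrite Hm0 Hmm mulr0 !addr0.
- move=> m t s.
  have EL := nae_lhs_lin e%:C hu Tphi TPk.
  have ER := @nae_rhs_lin R u u (wave_input u k) e phi (fun j => Phi j k) hu erefl erefl
    sb (smooth_cos_wave k) Tphi TPk.
  rewrite -[nae_lhs _ _]/(nae_lhs u (ser_lin e%:C phi (fun j => Phi j k))) EL ER.
  by rewrite /ser_lin eqc EPhi.
Qed.

End Combination.

(** * Fourier coefficients and norms *)

Section Fourier.
Context {R : realType}.
Implicit Types (f g : R -> R[i]) (z w : R[i]) (F G : R -> R).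
Local Notation mu := (@lebesgue_measure R).
Local Notation period := (`[0, pi *+ 2]%classic).

Let p2_gt0 : 0 < pi *+ 2 :> R. Proof. by rewrite mulrn_wgt0// pi_gt0. Qed.
Let p2_ge0 : 0 <= pi *+ 2 :> R. Proof. exact: ltW. Qed.
Let p2_neq0 : pi *+ 2 != 0 :> R. Proof. by rewrite gt_eqF. Qed.

Lemma continuous_integrable_period F : continuous F -> mu.-integrable period (EFin \o F).
Proof.
move=> cF; apply: continuous_compact_integrable; first exact: segment_compact.
exact: continuous_subspaceT.
Qed.

Lemma Rintegral_period_cst (c : R) : \int[mu]_(x in period) c = c * pi *+ 2.
Proof.
have E : mu period = (pi *+ 2)%:E.
  apply: etrans (lebesgue_measure_itv _) _; rewrite /= lte_fin p2_gt0.
  by rewrite -EFinB subr0.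
rewrite Rintegral_cst//; transitivity (c * fine (mu period)); first by [].
by rewrite E mulrnAr.
Qed.

Lemma Rintegral_period_le F (C : R) : continuous F ->
  (forall x, 0 <= x <= pi *+ 2 -> `|F x| <= C) ->
  `|\int[mu]_(x in period) F x| <= C * pi *+ 2.
Proof.
move=> cF FC; have iF := continuous_integrable_period cF.
apply: le_trans (le_normr_Rintegral _ iF) _ => //.
rewrite -Rintegral_period_cst; apply: le_Rintegral => //.
- apply: (@continuous_integrable_period (fun x => `|F x|)) => x.
  by apply: continuous_comp; [exact: cF|exact: norm_continuous].
- by apply: (@continuous_integrable_period (fun=> C)) => x; exact: cst_continuous.
Qed.

Definition ccont f : Prop := continuous (fun x => complex.Re (f x)) /\
  continuous (fun x => complex.Im (f x)).

Lemma csmooth_ccont f : csmooth_per f -> ccont f.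
Proof.
by move=> [sr si]; split=> x; [exact: (smooth_continuous sr)|exact: (smooth_continuous si)].
Qed.

Lemma ccont_cst z : ccont (fun=> z).
Proof. by split=> x; exact: cst_continuous. Qed.

Lemma ccontD f g : ccont f -> ccont g -> ccont (fun x => f x + g x).
Proof.
move=> [fr fi] [gr gi]; split=> x.
  by under eq_fun do rewrite Re_add; apply: continuousD; [exact: fr|exact: gr].
by under eq_fun do rewrite Im_add; apply: continuousD; [exact: fi|exact: gi].
Qed.

Lemma ccontM f g : ccont f -> ccont g -> ccont (fun x => f x * g x).
Proof.
move=> [fr fi] [gr gi]; split.
  have -> : (fun x => complex.Re (f x * g x)) = fun x =>
      complex.Re (f x) * complex.Re (g x) - complex.Im (f x) * complex.Im (g x).
    by apply/funext => x; rewrite Re_mul.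
  by move=> x; exact: (continuousB (continuousM (fr x) (gr x)) (continuousM (fi x) (gi x))).
have -> : (fun x => complex.Im (f x * g x)) = fun x =>
    complex.Re (f x) * complex.Im (g x) + complex.Im (f x) * complex.Re (g x).
  by apply/funext => x; rewrite Im_mul.
by move=> x; exact: (continuousD (continuousM (fr x) (gi x)) (continuousM (fi x) (gr x))).
Qed.

Lemma ccont_expi (a b : R) : ccont (fun x => expi (a * x + b)).
Proof.
have L x : {for x, continuous (fun x : R => a * x + b)}.
  by apply: continuousD; [apply: continuousM; [exact: cst_continuous|exact: cvg_id]
    |exact: cst_continuous].
by split=> x /=; apply: (continuous_comp (L x)); [exact: continuous_cos|exact: continuous_sin].
Qed.

Lemma ccont_kernel (k : int) : ccont (fun s => expi (- (k%:~R * s))).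
Proof.
have := ccont_expi (- k%:~R) 0; congr ccont; apply/funext => s.
by rewrite addr0 mulNr.
Qed.

Lemma cintD f g : ccont f -> ccont g -> cint (fun x => f x + g x) = cint f + cint g.
Proof.
move=> [fr fi] [gr gi]; rewrite /cint.
under eq_Rintegral do rewrite Re_add.
under [in X in _ +i* X]eq_Rintegral do rewrite Im_add.
by rewrite !RintegralD//; exact: continuous_integrable_period.
Qed.

Lemma cintZ z f : ccont f -> cint (fun x => z * f x) = z * cint f.
Proof.
move=> [fr fi]; have ir := continuous_integrable_period fr.
have ii := continuous_integrable_period fi.
have iZ (a : R) F : continuous F -> mu.-integrable period (EFin \o (fun x => a * F x)).
  move=> cF; apply: continuous_integrable_period => x.
  by apply: continuousM; [exact: cst_continuous|exact: cF].
rewrite /cint; under eq_Rintegral do rewrite Re_mul.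
under [in X in _ +i* X]eq_Rintegral do rewrite Im_mul.
rewrite RintegralB//; [|exact: iZ..]; rewrite RintegralD//; [|exact: iZ..].
by rewrite !RintegralZl//; apply: complex_ext; rewrite ?Re_mul ?Im_mul.
Qed.

(** Both parts are bounded, instead of the modulus, because [cint] integrates by parts of the
    complex number. A product then costs a factor 2, which only affects constants. *)
Definition cbound (C : R) z : Prop := `|complex.Re z| <= C /\ `|complex.Im z| <= C.

Lemma cboundM C D z w : cbound C z -> cbound D w -> cbound (2 * C * D) (z * w).
Proof.
move=> [zr zi] [wr wi].
have H (a b c d : R) : `|a| <= C -> `|b| <= D -> `|c| <= C -> `|d| <= D ->
    `|a * b| + `|c * d| <= 2 * C * D.
  move=> aC bD cC dD; rewrite !normrM -mulrA mulr2n mulrDl mul1r.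
  by apply: lerD; apply: ler_pM.
split.
  by rewrite Re_mul; apply: le_trans (ler_normB _ _) _; exact: H.
by rewrite Im_mul; apply: le_trans (ler_normD _ _) _; exact: H.
Qed.

Lemma cboundD C D z w : cbound C z -> cbound D w -> cbound (C + D) (z + w).
Proof.
by move=> [zr zi] [wr wi]; split; rewrite ?Re_add ?Im_add (le_trans (ler_normD _ _))// lerD.
Qed.

Lemma cbound_le C D z : C <= D -> cbound C z -> cbound D z.
Proof. by move=> CD [zr zi]; split; exact: le_trans CD. Qed.

Lemma cbound_expi (x : R) : cbound 1 (expi x).
Proof. by split; [exact: cos_max|exact: sin_max]. Qed.

Lemma fourier1D f g k : ccont f -> ccont g ->
  fourier1 (fun x => f x + g x) k = fourier1 f k + fourier1 g k.
Proof.
move=> cf cg; rewrite /fourier1 -mulrDr; congr (_ * _).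
rewrite -cintD; [|exact: (ccontM cf (ccont_kernel k))|exact: (ccontM cg (ccont_kernel k))].
by congr cint; apply/funext => s; rewrite mulrDl.
Qed.

Lemma fourier1Z z f k : ccont f -> fourier1 (fun x => z * f x) k = z * fourier1 f k.
Proof.
move=> cf; rewrite /fourier1 mulrCA; congr (_ * _).
rewrite -cintZ; last exact: (ccontM cf (ccont_kernel k)).
by congr cint; apply/funext => s; rewrite mulrA.
Qed.

Lemma fourier1_bound f C k : ccont f -> (forall x, 0 <= x <= pi *+ 2 -> cbound C (f x)) ->
  cbound (2 * C) (fourier1 f k).
Proof.
move=> cf fC; have [gr gi] := ccontM cf (ccont_kernel k).
have gC x : 0 <= x <= pi *+ 2 -> cbound (2 * C) (f x * expi (- (k%:~R * x))).
  by move=> /fC xC; have := cboundM xC (cbound_expi (- (k%:~R * x))); rewrite mulr1.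
have H (y : R) : `|y| <= 2 * C * pi *+ 2 -> `|(pi *+ 2)^-1 * y| <= 2 * C.
  move=> yC; rewrite normrM ger0_norm ?invr_ge0// ler_pdivrMl//.
  by rewrite mulrC mulrnAr.
rewrite /fourier1; split; rewrite ?Re_mul ?Im_mul /= mul0r ?subr0 ?addr0; apply: H.
  by apply: Rintegral_period_le => // x /gC[].
by apply: Rintegral_period_le => // x /gC[].
Qed.

Lemma fourier1_cst z : fourier1 (fun=> z) 0 = z.
Proof.
rewrite /fourier1; under eq_fun do rewrite mul0r oppr0 expi0 mulr1.
rewrite /cint !Rintegral_period_cst.
have H (x : R) : (pi *+ 2)^-1 * (x * pi *+ 2) = x by rewrite -mulrnAr mulrCA mulVf// mulr1.
by apply: complex_ext; rewrite ?Re_mul ?Im_mul /= mul0r ?subr0 ?addr0 H.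
Qed.

Lemma Rintegral_cos_eq0 (l : int) (x0 : R) : l != 0 ->
  \int[mu]_(x in period) cos (l%:~R * x + x0) = 0.
Proof.
move=> l0; have lR0 : l%:~R != 0 :> R by rewrite intr_eq0.
pose F (x : R) := (l%:~R)^-1 * sin (l%:~R * x + x0).
have DF (x : R) : is_derive x (1 : R) F (cos (l%:~R * x + x0)).
  have L := is_derive_lin l%:~R x0 x.
  have S := @is_derive1_comp R sin (fun x : R => l%:~R * x + x0) x _ _ (is_derive_sin _) L.
  have := @is_deriveZ R R R _ (l%:~R)^-1 x 1 _ S.
  by rewrite /GRing.scale /= mulrCA mulVf// mulr1.
have cF : continuous F.
  by move=> x; apply/differentiable_continuous/derivable1_diffP; exact: ex_derive.
rewrite /Rintegral (@continuous_FTC2 R _ F 0 (pi *+ 2)) //=.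
- rewrite -mulrBr; have -> : l%:~R * (pi *+ 2) + x0 = x0 + (pi *+ 2) *~ l.
    by rewrite addrC mulrzl.
  by rewrite mulr0 add0r periodicz ?subrr ?mulr0//; exact: sinD2pi.
- by apply: continuous_subspaceT => x; exact: ((ccont_expi l%:~R x0).1 x).
- split=> [x _||]; first exact: ex_derive.
    by apply: cvg_at_right_filter; exact: cF.
  by apply: cvg_at_left_filter; exact: cF.
- by move=> x _; rewrite derive1E; have := DF x => Dx; rewrite derive_val.
Qed.

Lemma cint_expi_eq0 (l : int) : l != 0 -> cint (fun s : R => expi (l%:~R * s)) = 0.
Proof.
move=> l0; apply: complex_ext => /=.
  by rewrite -[RHS](Rintegral_cos_eq0 0 l0); apply: eq_Rintegral => x _; rewrite addr0.
rewrite -[RHS](Rintegral_cos_eq0 (- (pi / 2)) l0); apply: eq_Rintegral => x _.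
by rewrite cosBpihalf.
Qed.

Lemma fourier1_cos_eq0 (e : R) (k : nat) (n : int) : n != k -> n != - (k%:Z) ->
  fourier1 (fun s : R => (e * cos (k%:R * s))%:C) n = 0.
Proof.
move=> nk nNk.
have cE (l : int) : ccont (fun s : R => expi (l%:~R * s)).
  by have := ccont_expi l%:~R 0; congr ccont; apply/funext => s; rewrite addr0.
rewrite /fourier1; have -> : (fun s : R => (e * cos (k%:R * s))%:C * expi (- (n%:~R * s))) =
    fun s => (2^-1 * e%:C) * (expi ((k%:Z - n)%:~R * s) + expi ((- k%:Z - n)%:~R * s)).
  apply/funext => s; rewrite rmorphM /= cos_expi !intrB intrN.
  by rewrite !mulrBl !expiD mulNr -[k%:~R]/(k%:R); ring.
rewrite cintZ; last exact: (ccontD (cE _) (cE _)).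
rewrite (cintD (cE _) (cE _)) !cint_expi_eq0 ?addr0 ?mulr0//.
- by rewrite subr_eq0 eq_sym.
- by rewrite subr_eq0 eq_sym.
Qed.

Lemma Rintegral_sin2 (k : nat) : (0 < k)%N ->
  \int[mu]_(x in period) (sin (k%:R * x) ^+ 2) = pi.
Proof.
move=> k0.
have cC : continuous (fun x : R => 2^-1 * cos ((k.*2)%:Z%:~R * x + 0)).
  have cF : continuous (fun x : R => cos ((k.*2)%:Z%:~R * x + 0)).
    by move=> x; exact: ((ccont_expi (k.*2)%:Z%:~R 0).1 x).
  by move=> x; exact: (continuousM (@cst_continuous R R 2^-1 x) (cF x)).
transitivity (\int[mu]_(x in period) (2^-1 - 2^-1 * cos ((k.*2)%:Z%:~R * x + 0))).
  apply: eq_Rintegral => x _; rewrite addr0 -[(k.*2)%:Z%:~R]/((k.*2)%:R).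
  have -> : (k.*2)%:R * x = (k%:R * x) *+ 2 by rewrite -mul2n natrM -mulrA mulr_natl.
  by rewrite cos_mulr2n sin2cos2; field.
rewrite RintegralB//; last 2 first.
- by apply: (@continuous_integrable_period (fun=> 2^-1)) => x; exact: cst_continuous.
- exact: continuous_integrable_period.
rewrite Rintegral_period_cst RintegralZl//; last first.
  by apply: continuous_integrable_period => x; exact: ((ccont_expi (k.*2)%:Z%:~R 0).1 x).
rewrite Rintegral_cos_eq0 ?mulr0 ?subr0; last by rewrite -[_ == _]/(k.*2 == 0)%N double_eq0 -lt0n.
by rewrite -mulr_natr mulrAC mulVf ?mul1r.
Qed.

End Fourier.

(** * Fourier coefficients of oscillating functions *)

Section OscFourier.
Context {R : realType}.
Local Notation mu := (@lebesgue_measure R).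
Local Notation period := (`[0, pi *+ 2]%classic).

Lemma Im_realM (x : R) z : complex.Im (x%:C * z) = x * complex.Im z.
Proof. by rewrite Im_mul /= mul0r addr0. Qed.

Lemma osc_ccont_s M r f k t : osc M r f -> ccont (fun s : R => f k t s).
Proof.
elim=> [|a n l x c ar nM sc|{}f g _ Cf _ Cg]; [exact: ccont_cst| |exact: ccontD].
apply: ccontM; last exact: ccont_cst.
apply: ccontM; last exact: csmooth_ccont.
exact: (csmooth_ccont (csmooth_real (smoothM (smooth_cst _) (smooth_cosD l k x)))).
Qed.

Lemma ccont_freq (j : R) : ccont (fun t => expi (j * t)).
Proof. by have := ccont_expi j 0; congr ccont; apply/funext => s; rewrite addr0. Qed.

Let fourier1_gen (h : R -> R[i]) (j : R) (n : int) : ccont h ->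
  (fun t => fourier1 (fun s => h s * expi (j * t)) n) = fun t => fourier1 h n * expi (j * t).
Proof.
move=> ch; apply/funext => t.
rewrite -[RHS]mulrC -fourier1Z//; congr (fourier1 _ n).
by apply/funext => s; rewrite mulrC.
Qed.

Lemma osc_ccont_fourier M r f k n : osc M r f -> ccont (fun t : R => fourier1 (f k t) n).
Proof.
elim=> [|a p l x c ar pM sc|{}f g Tf Cf Tg Cg].
- exact: (ccont_cst (fourier1 (fun=> 0) n)).
- rewrite fourier1_gen; first exact: (ccontM (ccont_cst _) (ccont_freq _)).
  apply: ccontM; last exact: csmooth_ccont.
  exact: (csmooth_ccont (csmooth_real (smoothM (smooth_cst _) (smooth_cosD l k x)))).
- have -> : (fun t => fourier1 (fun s => f k t s + g k t s) n) =
      fun t => fourier1 (f k t) n + fourier1 (g k t) n.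
    by apply/funext => t; rewrite fourier1D//; [exact: osc_ccont_s Tf|exact: osc_ccont_s Tg].
  exact: ccontD.
Qed.

Lemma fourier2D M r M' r' f g k j n : osc M r f -> osc M' r' g ->
  fourier2 (fun t s : R => f k t s + g k t s) j n = fourier2 (f k) j n + fourier2 (g k) j n.
Proof.
move=> Tf Tg; rewrite /fourier2.
rewrite -(fourier1D j (osc_ccont_fourier k n Tf) (osc_ccont_fourier k n Tg)).
congr (fourier1 _ j); apply/funext => t.
by rewrite fourier1D//; [exact: osc_ccont_s Tf|exact: osc_ccont_s Tg].
Qed.

(** The analytic content of the class: the constant depends neither on [k] nor on the Fourier
    indices, so it also serves at the index [(0, k)] that moves with [k]. *)
Lemma osc_fourier2 M r f : osc M r.+1 f -> exists2 C : R, 0 <= C &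
  forall k j n, (0 < k)%N -> cbound (C * k%:R ^+ r) (fourier2 (f k) j n).
Proof.
elim=> [|a p l x c ar pM sc|{}f g Tf [C C0 HC] Tg [D D0 HD]].
- exists 0 => // k j n _; rewrite mul0r.
  have Z m : fourier1 (fun _ : R => 0 : R[i]) m = 0.
    by have := fourier1Z 0 m (ccont_cst (0 : R[i])); rewrite !mul0r.
  rewrite /fourier2 (_ : (fun _ : R => _) = fun=> 0); last by apply/funext=> t; rewrite Z.
  by rewrite Z; split; rewrite normr0.
- have [cr ci] := sc.
  have [C1 C10 H1] := smooth_ubound cr; have [C2 C20 H2] := smooth_ubound ci.
  (* A factor 2 for each of the two Fourier integrals, and one more for the product with the
     exponential in [theta]. *)
  exists (8 * (C1 + C2)) => [|k j n k0]; first by rewrite mulr_ge0// addr_ge0.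
  pose h s := (k%:R ^+ a * cos (l%:R * k%:R * s + x))%:C * c s.
  have ch : ccont h.
    apply: ccontM; last exact: csmooth_ccont.
    exact: (csmooth_ccont (csmooth_real (smoothM (smooth_cst _) (smooth_cosD l k x)))).
  have hb s : 0 <= s <= pi *+ 2 -> cbound ((C1 + C2) * k%:R ^+ r) (h s).
    move=> s2; have B : cbound (C1 + C2) (c s).
      by split; [rewrite (le_trans (H1 s s2))// lerDl|rewrite (le_trans (H2 s s2))// lerDr].
    have kr : (k%:R : R) ^+ a <= k%:R ^+ r by rewrite ler_weXn2l// ?ler1n// -ltnS.
    have ck : `|(k%:R : R) ^+ a * cos (l%:R * k%:R * s + x)| <= k%:R ^+ r.
      rewrite normrM ger0_norm ?exprn_ge0//; apply: le_trans kr.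
      by rewrite ler_piMr ?exprn_ge0// cos_max.
    case: B => Br Bi; split; rewrite ?Re_mul ?Im_mul /= mul0r ?subr0 ?addr0 normrM mulrC;
      by apply: ler_pM.
  rewrite /fourier2 (fourier1_gen _ _ ch).
  have F1 := fourier1_bound n ch hb.
  have cF := ccontM (ccont_cst (fourier1 h n)) (ccont_freq (2 * p%:R - M%:R)).
  have F2 := @fourier1_bound R _ _ j cF (fun t _ => cboundM F1 (cbound_expi _)).
  by apply: cbound_le F2; rewrite le_eqVlt; apply/orP; left; apply/eqP; ring.
- exists (C + D) => [|k j n k0]; first exact: addr_ge0.
  by rewrite (fourier2D k j n Tf Tg) mulrDl; apply: cboundD; [exact: HC|exact: HD].
Qed.

(** The imaginary part of [sin (k s) e^(- i k s)] is [- sin (k s)^2], of constant sign. No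
    cancellation occurs, and the minimum of the amplitude gives the bound. *)
Lemma lead_fourier2 (u : nae_input R) m : admissible u -> ~~ odd m -> (1 < m)%N ->
  exists2 e : R, 0 < e & forall k, (0 < k)%N ->
    complex.Im (fourier2 (lead u m k) 0 k%:Z) <= - (e * k%:R ^+ m.-1).
Proof.
move=> hu om m1; have sG := smooth_lead_amp hu m.
have [e e0 He] := smooth_lbound sG (fun s => lead_amp_gt0 hu s om m1).
exists (2^-1 * e) => [|k k0]; first by rewrite mulr_gt0.
have -> : fourier2 (lead u m k) 0 k%:Z = fourier1 (lead u m k 0) k%:Z.
  by rewrite /fourier2 /lead /wave fourier1_cst.
rewrite /fourier1 Im_realM.
pose G := lead_amp u m.
have -> : complex.Im (cint (fun s => lead u m k 0 s * expi (- (k%:Z%:~R * s)))) =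
    \int[mu]_(s in period) (- (k%:R ^+ m.-1) * (G s * sin (k%:R * s) ^+ 2)).
  apply: eq_Rintegral => s _.
  rewrite /lead /wave -rmorphM Im_realM /= sinN mul1r cosBpihalf.
  by rewrite -[k%:Z%:~R]/(k%:R : R) -/G; ring.
have cs : continuous (fun s : R => sin (k%:R * s) ^+ 2).
  have -> : (fun s : R => sin (k%:R * s) ^+ 2) = fun s => sin (k%:R * s) * sin (k%:R * s).
    by apply/funext => s; rewrite expr2.
  by move=> s; exact: (continuousM ((ccont_freq k%:R).2 s) ((ccont_freq k%:R).2 s)).
have cG : continuous (fun s : R => G s * sin (k%:R * s) ^+ 2).
  by move=> s; exact: (continuousM (smooth_continuous sG (x:=s)) (cs s)).
have iG := continuous_integrable_period cG.
rewrite RintegralZl; [|exact: measurable_itv|exact: iG].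
rewrite mulrCA mulNr lerN2 [leRHS]mulrC ler_wpM2r ?exprn_ge0//.
have : e * pi <= \int[mu]_(s in period) (G s * sin (k%:R * s) ^+ 2).
  have ce : continuous (fun s : R => e * sin (k%:R * s) ^+ 2).
    by move=> s; exact: (continuousM (@cst_continuous R R e s) (cs s)).
  have <- : \int[mu]_(s in period) (e * sin (k%:R * s) ^+ 2) = e * pi.
    rewrite RintegralZl; [|exact: measurable_itv|exact: continuous_integrable_period].
    by rewrite Rintegral_sin2.
  apply: le_Rintegral; [exact: measurable_itv|exact: continuous_integrable_period|exact: iG|].
  by move=> s; rewrite /= in_itv /= => s2; rewrite ler_wpM2r ?sqr_ge0//; exact: He.
have p2 : 0 < pi *+ 2 :> R by rewrite mulrn_wgt0 ?pi_gt0.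
rewrite (ler_pdivlMl _ _ p2) => H; apply: le_trans H.
by rewrite -mulr_natr le_eqVlt; apply/orP; left; apply/eqP; field.
Qed.

End OscFourier.

(** * Norms of the perturbation and lower bounds on Sobolev norms *)

Section Norms.
Context {R : realType}.

Lemma derive1n_zero (V : normedModType R) n : derive1n n (fun _ : R => 0 : V) = fun=> 0.
Proof.
elim: n => // n IHn; rewrite derive1nS IHn; apply/funext => x.
exact: (derive1_cst (0 : V) x).
Qed.

Lemma smooth_zero (V : normedModType R) : smooth_per (fun _ : R => 0 : V).
Proof. by split=> [n x|//]; rewrite derive1n_zero; exact: derivable_cst. Qed.

Lemma norm3_0 : norm3 (0 : 'rV[R]_3) = 0.
Proof. by rewrite /norm3 /dot3 big1 ?sqrtr0// => i _; rewrite mxE mul0r. Qed.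

Lemma ereal_sup_const (T : Type) (A : set T) (x0 : T) (c : \bar R) : A x0 ->
  ereal_sup [set c | x in A] = c.
Proof.
move=> Ax0; rewrite (_ : [set c | x in A] = [set c]) ?ereal_sup1//.
by apply/seteqP; split=> [_ [x _ <-]|_ ->] //; exists x0.
Qed.

Lemma Cnorm_zero (r : R) : Cnorm r (fun=> 0) = 0%E.
Proof.
rewrite /Cnorm big1 => [|i _]; last first.
  by rewrite derive1n_zero norm3_0 (ereal_sup_const _ (x0 := 0)).
rewrite add0e; case: ifP => // _.
rewrite (_ : (fun xy : R * R => _) = fun=> 0%E); last first.
  by apply/funext => xy; rewrite derive1n_zero subrr norm3_0 mul0r.
(* The supremum of an empty set would be [-oo], so a pair of distinct points must be exhibited. *)
apply: (ereal_sup_const _ (x0 := (0, 1))) => /=.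
by rewrite eq_sym oner_eq0.
Qed.

Lemma fourier1_zero n : fourier1 (fun _ : R => 0 : R[i]) n = 0.
Proof. by have := fourier1Z 0 n (ccont_cst (0 : R[i])); rewrite !mul0r. Qed.

Lemma Hnorm2_zero (q : R) : Hnorm2 q (fun _ _ => 0) = 0%E.
Proof.
rewrite /Hnorm2 esum1 ?poweR0r ?invr_neq0 ?pnatr_eq0// => jn _.
rewrite /fourier2 (_ : (fun _ : R => _) = fun=> 0).
  by rewrite fourier1_zero /abs2 /= expr0n addr0 mulr0.
by apply/funext => t; rewrite fourier1_zero.
Qed.

Lemma poweR_sqr (x : R) : ((x ^+ 2)%:E `^ 2^-1 = `|x|%:E)%E.
Proof. by rewrite poweR_EFin powR12_sqrt ?sqr_ge0// sqrtr_sqr. Qed.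

Lemma le_poweR2V (x y : \bar R) : (0 <= x)%E -> (x <= y)%E -> (x `^ 2^-1 <= y `^ 2^-1)%E.
Proof.
move=> x0 xy; apply: gt0_ler_poweR => //; rewrite ?invr_ge0//.
  by rewrite in_itv /= leey x0.
by rewrite in_itv /= leey (le_trans x0 xy).
Qed.

(** A single term bounds the sum from below, all weights being at least 1. *)
Lemma Hnorm2_ge (q : R) f j n : 0 <= q ->
  (`|complex.Im (fourier2 f j n)|%:E <= Hnorm2 q f)%E.
Proof.
move=> q0; rewrite /Hnorm2 -poweR_sqr; apply: le_poweR2V; first by rewrite lee_fin sqr_ge0.
apply: esum_ge; exists [set (j, n)].
  by split=> //; exact: finite_set1.
rewrite fsbig_set1 /= lee_fin; apply: (@le_trans _ _ (abs2 (fourier2 f j n))).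
  by rewrite lerDr sqr_ge0.
rewrite ler_peMl ?addr_ge0 ?sqr_ge0//.
have H1 : 1 <= 1 + j%:~R ^+ 2 + n%:~R ^+ 2 :> R by rewrite -addrA lerDl addr_ge0 ?sqr_ge0.
have := ge0_ler_powR q0 _ _ H1; rewrite powR1; apply; rewrite nnegrE//.
exact: le_trans H1.
Qed.

(** Only the modes [k] and [- k] contribute, and [1 + k^2 <= 2 k^2] together with [q <= N] replaces
    the real power of the weight by an integer one. *)
Lemma Hnorm1_cos (q e : R) (k N : nat) : 0 <= q <= N%:R -> (0 < k)%N ->
  (Hnorm1 q (fun s => (e * cos (k%:R * s))%:C) <=
   (Num.sqrt (16 * 2 ^+ N) * `|e| * k%:R ^+ N)%:E)%E.
Proof.
move=> /andP[q0 qN] k0; set S := Num.sqrt _ * _ * _.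
have S0 : 0 <= S by rewrite !mulr_ge0 ?sqrtr_ge0 ?exprn_ge0.
rewrite /Hnorm1 -[S]ger0_norm// -poweR_sqr; apply: le_poweR2V.
  by apply: esum_ge0 => n _; rewrite lee_fin mulr_ge0 ?powR_ge0 ?addr_ge0 ?sqr_ge0.
pose F (s : R) := (e * cos (k%:R * s))%:C; rewrite -/F.
pose z : int := k%:Z; pose mz : int := - z.
(* [8 e^2] comes from bounding both parts of a coefficient by [2 |e|]; the two modes together give
   the 16 of [S]. *)
pose b := (2 * k%:R ^+ 2) ^+ N * (8 * e ^+ 2).
have b0 : 0 <= b by apply: mulr_ge0; [apply: exprn_ge0|]; rewrite mulr_ge0 ?sqr_ge0.
have sumE : (\esum_(n in [set: int]) ((if n \in [set z] then b%:E else 0) +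
      (if n \in [set mz] then b%:E else 0)) = (S ^+ 2)%:E)%E.
  rewrite esumD; [|by move=> n _; case: ifP; rewrite ?lee_fin..].
  rewrite -!esum_mkcond !esum_set1 ?lee_fin//.
  rewrite -EFinD; congr EFin; rewrite /S !exprMn sqr_sqrtr ?mulr_ge0 ?exprn_ge0//.
  by rewrite real_normK ?num_real// /b exprMn -!exprM mulnC; ring.
rewrite -sumE; apply: le_esum => n _.
have cF : ccont F.
  apply: csmooth_ccont; apply: csmooth_real; apply: (smoothM (smooth_cst e)).
  exact: smooth_cos_wave.
have abF : abs2 (fourier1 F n) <= 8 * e ^+ 2.
  have Fb x : 0 <= x <= pi *+ 2 -> cbound `|e| (F x).
    move=> _; split; rewrite /= ?normr0// normrM -[leRHS]mulr1.
    by rewrite ler_wpM2l// cos_max.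
  have [Br Bi] := fourier1_bound n cF Fb.
  have sq (x : R) : `|x| <= 2 * `|e| -> x ^+ 2 <= 4 * e ^+ 2.
    move=> xe; rewrite -[x ^+ 2]real_normK ?num_real// -[e ^+ 2]real_normK ?num_real//.
    have -> : 4 * `|e| ^+ 2 = (2 * `|e|) ^+ 2 by ring.
    by rewrite lerXn2r ?nnegrE// mulr_ge0.
  rewrite /abs2; have := lerD (sq _ Br) (sq _ Bi); lra.
have bn (m : int) : m%:~R ^+ 2 = k%:R ^+ 2 :> R -> (1 + m%:~R ^+ 2) `^ q * abs2 (fourier1 F n) <= b.
  move=> ->; apply: ler_pM => //; rewrite ?powR_ge0 ?addr_ge0 ?sqr_ge0//.
  have k1 : 1 <= k%:R ^+ 2 :> R by rewrite exprn_ege1// ler1n.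
  have k2 : 1 <= 2 * k%:R ^+ 2 :> R by lra.
  rewrite -(powR_mulrn N (le_trans ler01 k2)); apply: le_trans (ler_powR k2 qN).
  apply: (ge0_ler_powR q0).
  - by rewrite nnegrE addr_ge0// sqr_ge0.
  - by rewrite nnegrE (le_trans ler01 k2).
  - lra.
rewrite !in_set1.
have [nk|nk] := eqVneq n z.
  have T1 : (b%:E <= b%:E + (if n == mz then b%:E else 0))%E.
    by rewrite leeDl//; case: ifP; rewrite ?lee_fin.
  by apply: le_trans T1; rewrite lee_fin; apply: bn; rewrite nk.
have [nNk|nNk] := eqVneq n mz.
  by rewrite add0e lee_fin; apply: bn; rewrite nNk intrN sqrrN.
by rewrite adde0 (fourier1_cos_eq0 e nk nNk) /abs2 /= expr0n addr0 mulr0.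
Qed.

End Norms.

(** * The perturbed problems and ill-posedness *)

Section Perturbation.
Context {R : realType}.
Implicit Types (u : nae_input R) (e : R) (k : nat).

Lemma admissible_field_wave u e k : admissible u ->
  (forall s, 0 < field0 u s + e * cos (k%:R * s)) ->
  admissible (add_input u (field_wave e k)).
Proof.
move=> [[sa sb sm] pos] B0; rewrite add_field_wave; split.
  split; [exact: sa| |exact: sm].
  exact: (smoothD sb (smoothM (smooth_cst e) (smooth_cos_wave k))).
by move=> s; have [] := pos s; split=> //; exact: B0.
Qed.

Lemma smooth_input_field_wave e k : smooth_input (field_wave e k).
Proof.
split; first exact: smooth_zero.
  exact: (smoothM (smooth_cst e) (smooth_cos_wave k)).
by move=> m _; split; exact: csmooth_cst.
Qed.

Lemma ser_norm_IC_field_wave (sigma q : R) e k :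
  ser_norm sigma (Hnorm2 q) (ser_IC (field_wave e k)) = 0%E.
Proof.
have IC0 m : ser_IC (field_wave e k) m = fun _ _ => 0.
  apply/funext => t; apply/funext => s; rewrite /ser_IC /=.
  by case: ifP => // _; rewrite !mul0r addr0.
rewrite /ser_norm (_ : (fun m => _) = fun=> 0%E).
  exact: (ereal_sup_const 0%E (x0 := 0%N)).
by apply/funext => m; rewrite IC0 Hnorm2_zero mule0.
Qed.

Lemma fourier2Z M r (f : nat -> R -> R -> R[i]) k j n z : osc M r f ->
  fourier2 (fun t s => z * f k t s) j n = z * fourier2 (f k) j n.
Proof.
move=> Tf; rewrite /fourier2 -(fourier1Z z j (osc_ccont_fourier k n Tf)).
congr (fourier1 _ j); apply/funext => t.
by rewrite fourier1Z//; exact: osc_ccont_s Tf.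
Qed.

(** The leading term contributes at least [c k^(m-1)] and the remainder at most [C k^(m-2)];
    factoring out the smaller power leaves [c k - C]. *)
Lemma response_lower_bound u m (f : nat -> R -> R -> R[i]) : admissible u ->
  ~~ odd m -> (1 < m)%N -> osc (m - 2) m.-1 (fun k t s => f k t s - lead u m k t s) ->
  exists C c : R, 0 < c /\ forall e k, 0 <= e -> (0 < k)%N ->
    e * k%:R ^+ (m - 2) * (c * k%:R - C) <=
      `|complex.Im (fourier2 (fun t s => e%:C * f k t s) 0 k%:Z)|.
Proof.
move=> hu om m1 Trem; have [c c0 Hc] := lead_fourier2 hu om m1.
have mE : m.-1 = (m - 2).+1 by case: (m) m1 => [|[|p]]// _; rewrite subSS subSS subn0.
rewrite mE in Trem Hc; have [C C0 HC] := osc_fourier2 Trem.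
have Tlead := oscs_osc (oscs_lead hu m).
exists C, c; split=> // e k e0 k0.
have Tf : osc (m - 2) m f.
  have m2 : ((m - 2).+1 <= m)%N by rewrite -mE leq_pred.
  by apply: osc_ext (oscD (osc_le m2 Trem) Tlead) _ => k' t s; rewrite subrK.
rewrite (fourier2Z k _ _ _ Tf) Im_realM.
have -> : fourier2 (f k) 0 k%:Z = fourier2 (fun t s => f k t s - lead u m k t s) 0 k%:Z +
    fourier2 (lead u m k) 0 k%:Z.
  apply: etrans _ (fourier2D k 0 k%:Z Trem Tlead).
  have E : f k = fun t s => f k t s - lead u m k t s + lead u m k t s.
    by apply/funext => t; apply/funext => s; rewrite subrK.
  exact: (congr1 (fun h => fourier2 h 0 k%:Z) E).
have aux (x y K : R) : x <= - (c * (k%:R * K)) -> `|y| <= C * K ->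
    e * K * (c * k%:R - C) <= `|e * (y + x)|.
  move=> Hx Hy; rewrite normrM (ger0_norm e0) -mulrA ler_wpM2l//.
  have := ler_norm (- (y + x)); rewrite normrN.
  have := ler_norm y; lra.
have [_ Hrem] := HC k 0 k%:Z k0; have Hlead := Hc k k0; rewrite exprS in Hlead.
by rewrite Im_add; exact: aux Hlead Hrem.
Qed.

(** Uniqueness transfers the explicit superposition to an arbitrary solution of the perturbed
    problem. *)
Lemma nae_solution_diff u phi (Phi : nat -> nat -> R -> R -> R[i]) e k psi : admissible u ->
  nae_solution u phi -> (forall m, oscs 2 m m (Phi m)) ->
  (forall m t s, nae_lhs u (fun j => Phi j k) m t s =
                 nae_rhs (wave_input u k) (fun j => Phi j k) m t s) ->
  admissible (add_input u (field_wave e k)) ->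
  nae_solution (add_input u (field_wave e k)) psi ->
  forall m, ser_add psi (ser_opp phi) m = fun t s => e%:C * Phi m k t s.
Proof.
move=> hu Hphi TPhi EPhi hue Hpsi m.
have Hlin := nae_solution_field_wave e hu Hphi TPhi EPhi.
rewrite (nae_solution_unique hue Hpsi Hlin); apply/funext => t; apply/funext => s.
by rewrite /ser_add /ser_opp /ser_lin addrC addKr.
Qed.

End Perturbation.

Local Close Scope complex_scope.

Theorem theorem3p6 (R : realType) (u : nae_input R) (q0 : R) (phi : fseries R)
    (hu : admissible u) (hq0 : 0 <= q0) (hphi : nae_solution u phi) :
  forall sigma0 sigma q : R, 0 < sigma0 -> 0 < sigma -> 2 <= q ->
  exists d : nat -> nae_input R,
    (forall j, smooth_input (d j)) /\
    (forall j, admissible (add_input u (d j))) /\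
    (real_moments u -> forall j, real_moments (add_input u (d j))) /\
    (fun j => Cnorm (4 + q0) (axis (d j))) @ \oo --> 0%E /\
    (fun j => Hnorm1 (1 + q0) (fun s => real_complex R (field0 (d j) s)))
      @ \oo --> 0%E /\
    (fun j => ser_norm sigma0 (Hnorm2 (2 + q0)) (ser_IC (d j)))
      @ \oo --> 0%E /\
    (forall j, exists psi, nae_solution (add_input u (d j)) psi) /\
    (forall psi : nat -> fseries R,
      (forall j, nae_solution (add_input u (d j)) (psi j)) ->
      ~ (fun j => ser_norm sigma (Hnorm2 q) (ser_add (psi j) (ser_opp phi)))
          @ \oo --> 0%E).
Proof.
move=> sigma0 sigma q _ sigma_gt0 q2.
have [Phi [TPhi [TPhi_lead EPhi]]] := response hu.
(* By compactness of a period [B_0] has a positive margin [eta]; amplitudes up to [eta] keep the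
   field positive. *)
have [eta eta0 Heta] : exists2 eta : R, 0 < eta & forall s, eta < field0 u s.
  have [[_ sb _] pos] := hu.
  have B0 s : 0 < field0 u s by have [] := pos s.
  have [b b0 Hb] := smooth_lbound sb B0.
  exists (b / 2) => [|s]; first by rewrite divr_gt0.
  have [y y2 ->] := periodic_reduce s sb.2; have := Hb y y2; lra.
(* [N >= 1 + q0], so the norm of [cos (k s)] in the field space is [O(k^N)]. The exponent [N + 1] in
   the amplitude leaves a factor [1 / k], where [k = j + 1] is positive. *)
pose N := (Num.truncn q0).+2.
pose e (j : nat) : R := eta / j.+1%:R ^+ N.+1.
have jN j : 1 <= (j.+1%:R : R) ^+ N.+1 by rewrite exprn_ege1// ler1n.
have e0 j : 0 <= e j by rewrite divr_ge0 ?exprn_ge0// ltW.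
have e_eta j : e j <= eta.
  by rewrite ler_pdivrMr ?(lt_le_trans ltr01)// ler_peMr// ltW.
exists (fun j => field_wave (e j) j.+1).
have adm j : admissible (add_input u (field_wave (e j) j.+1)).
  apply: admissible_field_wave => // s; have := Heta s.
  have : - e j <= e j * cos (j.+1%:R * s).
    by rewrite -[- e j]mulrN1 ler_wpM2l// cos_geN1.
  have := e_eta j; lra.
split; [|split; [|split; [|split; [|split; [|split; [|split]]]]]].
- by move=> j; exact: smooth_input_field_wave.
- exact: adm.
- by move=> ru j; rewrite add_field_wave.
- by under eq_fun do rewrite Cnorm_zero; exact: cvg_cst.
- pose K := Num.sqrt (16 * 2 ^+ N) * eta.
  apply: (@squeeze_cvge _ _ _ _ (cst 0%E) _ (fun j => (K * harmonic j)%:E)).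
  + apply: nearW => j; rewrite poweR_ge0 /=.
    have qN : 0 <= 1 + q0 <= N%:R.
      rewrite addr_ge0//= /N -natr1 addrC lerD2r ltW// truncnS_gt//.
    have E : Num.sqrt (16 * 2 ^+ N) * `|e j| * j.+1%:R ^+ N = K * harmonic j.
      rewrite (ger0_norm (e0 j)) /K /e /harmonic /= (exprS _ N).
      have : (j.+1%:R : R) ^+ N != 0 by rewrite expf_neq0 ?pnatr_eq0.
      have : (j.+1%:R : R) != 0 by rewrite pnatr_eq0.
      move: (j.+1%:R : R) (j.+1%:R ^+ N : R) => x y x0 y0.
      by field; rewrite x0 y0.
    by rewrite -E; exact: Hnorm1_cos.
  + exact: cvg_cst.
  + apply: cvg_EFin; first exact: nearW.
    rewrite -[X in _ --> X](mulr0 K); apply: cvgM; first exact: cvg_cst.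
    exact: cvg_harmonic.
- by under eq_fun do rewrite ser_norm_IC_field_wave; exact: cvg_cst.
- move=> j; eexists; exact: (nae_solution_field_wave (e j) hu hphi TPhi (EPhi j.+1)).
- move=> psi Hpsi.
  (* Doubling makes [m] even, as the leading term requires, and [m - 2 = 2 (N + 1)] leaves [k^(N+1)]
     after multiplication by the amplitude. *)
  pose m := N.+2.*2.
  have m1 : (1 < m)%N by [].
  have om : ~~ odd m by rewrite odd_double.
  have Tm : osc (m - 2) m.-1 (fun k t s => Phi m k t s - lead u m k t s).
    exact: oscs_osc (TPhi_lead m).
  have [C [c [c0 Hc]]] := response_lower_bound hu om m1 Tm.
  (* Once [c k - C >= 1], the order-[m] coefficient alone keeps the norm above a positive constant
     independent of [j], which already excludes convergence. *)
  have low j : (1 <= c * j.+1%:R - C) -> ((sigma ^+ m * eta)%:E <=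
      ser_norm sigma (Hnorm2 q) (ser_add (psi j) (ser_opp phi)))%E.
    move=> cj; apply: (@le_trans _ _ ((sigma ^+ m)%:E *
        Hnorm2 q (ser_add (psi j) (ser_opp phi) m))%E); last first.
      by apply: ereal_sup_ubound; exists m.
    rewrite EFinM lee_wpmul2l ?lee_fin ?exprn_ge0 ?(ltW sigma_gt0)//.
    rewrite (nae_solution_diff hu hphi TPhi (EPhi j.+1) (adm j) (Hpsi j)).
    apply: le_trans (Hnorm2_ge _ 0 j.+1%:Z _); last by apply: le_trans q2.
    rewrite lee_fin; apply: le_trans (Hc _ _ (e0 j) (ltn0Sn j)).
    have k1 : 1 <= j.+1%:R :> R by rewrite ler1n.
    have -> : (m - 2)%N = (N.+1 + N.+1)%N.
      by rewrite /m doubleS subSS subSS subn0 addnn.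
    rewrite exprD /e mulrA divfK ?gt_eqF ?(lt_le_trans ltr01)//.
    rewrite -mulrA ler_peMr ?(ltW eta0)//.
    exact: (mulr_ege1 (jN j) cj).
  move=> /(_ [set x | (x < (sigma ^+ m * eta)%:E)%E]) H.
  have se : (0 < (sigma ^+ m * eta)%:E)%E by rewrite lte_fin mulr_gt0// exprn_gt0.
  have [n _ Hn] := H (open_ereal_lt' se).
  (* Past the rank [n] given by the assumed convergence, and large enough for
     [c (j + 1) >= C + 1]. *)
  pose j := maxn n (Num.truncn ((C + 1) / c)).
  have cj : 1 <= c * j.+1%:R - C.
    rewrite lerBrDr addrC mulrC -ler_pdivrMr//; apply: le_trans (ltW (truncnS_gt _)) _.
    by rewrite ler_nat ltnS leq_maxr.
  have := Hn j (leq_maxl _ _); rewrite /= ltNge => /negP; apply.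
  exact: low.
Qed.
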